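(* Let $n\ge 1$ and $0\le m\le n$ be integers, let $a_j,b_{jk}:[0,1]\times\mathbb{R}\to\mathbb{R}$ ($j,k\le n$) be functions, and let $R=(R_1,\dots,R_n)$ be a linear bounded operator from $BC_n$ to $BC_n(\mathbb{R})$. Suppose that: (1) $a_j,b_{jk}\in BC^1$ for all $j,k\le n$; (2) $\inf_{x,t}a_j(x,t)>0$ for all $1\le j\le m$ and $\sup_{x,t}a_j(x,t)<0$ for all $m<j\le n$; (3) the restriction of $R$ to $BC_n^1$ is a linear bounded operator from $BC_n^1$ to $BC_n^1(\mathbb{R})$; (4) for all $1\le j\ne k\le n$ there exists $\tilde b_{jk}\in BC^1$ such that $b_{jk}=\tilde b_{jk}(a_k-a_j)$ on $[0,1]\times\mathbb{R}$; (5) there exists $\ell\in\mathbb{N}$ such that $\|C^{\ell}\|_{\mathcal{L}(BC_n)}<1$, where $C:BC_n\to BC_n$ is the operator defined in the context; (6) for all $\varepsilon>0$ there exists a compact interval $I\subset\mathbb{R}$ such that $|b_{jk}(x,t)|<\varepsilon$ for all $1\le j\neq k\le n$, $x\in[0,1]$ and $t\in\mathbb{R}\setminus I$. For $f\in BC_n$ consider the boundary value problem $$(P_f)\qquad \begin{array}{l}\partial_t u_j+a_j(x,t)\partial_x u_j+\sum_{k=1}^n b_{jk}(x,t)u_k=f_j(x,t),\quad (x,t)\in(0,1)\times\mathbb{R},\ j\le n,\\ u_j(0,t)=(Ru)_j(t),\ 1\le j\le m,\qquad u_j(1,t)=(Ru)_j(t),\ m<j\le n,\quad t\in\mathbb{R}.\end{array}$$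 Let $\mathcal{K}$ denote the vector space of all bounded continuous solutions (in the sense defined in the context) to $(P_f)$ with $f\equiv0$. Then: (i) $\dim\mathcal{K}<\infty$, and the vector space of all $f\in BC_n$ such that there exists a bounded continuous solution to $(P_f)$ is a closed subspace of codimension $\dim\mathcal{K}$ in $BC_n$. (ii) If $\dim\mathcal{K}=0$, then for any $f\in BC_n$ there exists a unique bounded continuous solution $u$ to $(P_f)$.
   Context: Function spaces. $BC_n$ is the space of all bounded continuous maps $u:[0,1]\times\mathbb{R}\to\mathbb{R}^n$ with norm $\|u\|_\infty=\max_{j\le n}\max_{x\in[0,1]}\sup_{t\in\mathbb{R}}|u_j(x,t)|$. $BC_n^1$ is the Banach space of all $u\in BC_n$ with $\partial_xu,\partial_tu\in BC_n$, with norm $\|u\|_1=\|u\|_\infty+\|\partial_xu\|_\infty+\|\partial_tu\|_\infty$. $BC_n(\mathbb{R})$ is the space of bounded continuous maps $v:\mathbb{R}\to\mathbb{R}^n$ (sup norm), and $BC_n^1(\mathbb{R})$ is the space of all $v\in BC_n(\mathbb{R})$ with $v'\in BC_n(\mathbb{R})$ (with the corresponding $C^1$-norm). The subscript $n$ is dropped if $n=1$. $\mathcal{L}(BC_n)$ denotes the bounded linear operators on $BC_n$ with the operator norm. Characteristics. For $j\le n$, $x\in[0,1]$, $t\in\mathbb{R}$, the $j$-th characteristic $\xi\in[0,1]\mapsto\omega_j(\xi)=\omega_j(\xi,x,t)\in\mathbb{R}$ is the solution of $$\partial_\xi\omega_j(\xi,x,t)=\frac{1}{a_j(\xi,\omega_j(\xi,x,t))},\qquad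 \omega_j(x,x,t)=t.$$ Set $$c_j(\xi,x,t)=\exp\int_x^\xi\left(\frac{b_{jj}}{a_j}\right)(\eta,\omega_j(\eta))\,d\eta,\qquad d_j(\xi,x,t)=\frac{c_j(\xi,x,t)}{a_j(\xi,\omega_j(\xi))},$$ and $x_j=0$ for $1\le j\le m$, $x_j=1$ for $m<j\le n$. Operator $C$. $C:BC_n\to BC_n$ is defined by $(Cv)_j(x,t)=c_j(x_j,x,t)\,(Rv)_j(\omega_j(x_j,x,t))$, $j\le n$. Bounded continuous solution. A function $u\in BC_n$ is called a bounded continuous solution to $(P_f)$ if for all $j\le n$ and $(x,t)\in[0,1]\times\mathbb{R}$ $$u_j(x,t)=c_j(x_j,x,t)(Ru)_j(\omega_j(x_j))-\int_{x_j}^x d_j(\xi,x,t)\sum_{k\ne j}b_{jk}(\xi,\omega_j(\xi))u_k(\xi,\omega_j(\xi))\,d\xi+\int_{x_j}^x d_j(\xi,x,t)f_j(\xi,\omega_j(\xi))\,d\xi .$$ *)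

(* Defs.v *)
From HB Require Import structures.
From mathcomp Require Import all_boot all_order all_algebra.
From mathcomp Require Import all_classical all_reals all_analysis.
Export numFieldNormedType.Exports.

Set Implicit Arguments.
Unset Strict Implicit.
Unset Printing Implicit Defensive.

Import Order.TTheory GRing.Theory Num.Theory.
Import numFieldNormedType.Exports.

Local Open Scope classical_set_scope.
Local Open Scope ring_scope.

Section supnorm.
Context {R : realType} {T : topologicalType} {V : normedModType R}.
Implicit Types f g : T -> V.

Definition supnorm f : R := sup (range (fun x => `|f x|)).

Definition bounded_continuous f : Prop := continuous f /\ bounded_fun f.

Lemma bounded_funE f : bounded_fun f <-> exists M, forall x, `|f x| <= M.
Proof.
split=> [/pinfty_ex_gt0 [M _ fM]|[M fM]]; first by exists M => x; exact: fM.
by exists M; split=> [|N MN x _]; [exact: num_real|exact: le_trans (fM x) (ltW MN)].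
Qed.

Lemma supnorm_ub f x : bounded_fun f -> `|f x| <= supnorm f.
Proof.
move=> /bounded_funE[M fM]; apply: ub_le_sup; last by exists x.
by exists M => _ [y _ <-]; exact: fM.
Qed.

Lemma supnorm_ge0 f : bounded_fun f -> 0 <= supnorm f.
Proof.
move=> bf; have [x|noT] := pselect (exists x : T, True).
  by have [y _] := x; exact: le_trans (supnorm_ub y bf).
rewrite /supnorm [X in sup X](_ : _ = set0) ?sup0//.
by apply/seteqP; split=> // z [y]; case: noT; exists y.
Qed.

Lemma supnorm_le f M : 0 <= M -> (forall x, `|f x| <= M) -> supnorm f <= M.
Proof.
move=> M0 fM; have [[y _]|noT] := pselect (exists x : T, True).
  by apply: ge_sup; [exists `|f y|, y|move=> _ [z _ <-]].
rewrite /supnorm [X in sup X](_ : _ = set0) ?sup0//.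
by apply/seteqP; split=> // z [y]; case: noT; exists y.
Qed.

Definition bcfun : {pred T -> V} := fun f => `[< bounded_continuous f >].

Lemma bcfunP f : reflect (bounded_continuous f) (f \in bcfun).
Proof. exact: asboolP. Qed.

Lemma bcfun_submod_closed : submod_closed bcfun.
Proof.
split.
  apply/bcfunP; split; first exact: cst_continuous.
  by apply/bounded_funE; exists 0 => x; rewrite normr0.
move=> k f g /bcfunP[cf /bounded_funE[M fM]] /bcfunP[cg /bounded_funE[N gN]].
apply/bcfunP; split.
  by move=> x; apply: cvgD; [apply: cvgZr; exact: cf|exact: cg].
apply/bounded_funE; exists (`|k| * M + N) => x.
by rewrite (le_trans (ler_normD _ _))// lerD// normrZ ler_wpM2l.
Qed.

HB.instance Definition _ :=
  GRing.isSubmodClosed.Build R (T -> V) bcfun bcfun_submod_closed.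

End supnorm.

(* The maximum norm on 'rV[R]_n turns the norm of BC T 'rV[R]_n, defined below,
   into max_j sup_x |u_j x|. *)
Record BC (R : realType) (T : topologicalType) (V : normedModType R) :=
  MkBC { bcval :> T -> V; _ : bcval \in @bcfun R T V }.
Arguments BC : clear implicits.
Arguments BC {R} T V.
Arguments bcval {R T V}.

Section bc_normed.
Context {R : realType} {T : topologicalType} {V : normedModType R}.

HB.instance Definition _ := [isSub for @bcval R T V].
HB.instance Definition _ := [Choice of BC T V by <:].
HB.instance Definition _ := [SubChoice_isSubLmodule of BC T V by <:].

Implicit Types u v : BC T V.

Lemma bcP u : bounded_continuous u.
Proof. by apply/bcfunP; case: u. Qed.

Definition bcnorm u : R := supnorm u.

Lemma bcnormD u v : bcnorm (u + v) <= bcnorm u + bcnorm v.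
Proof.
have [[_ bu] [_ bv]] := (bcP u, bcP v).
apply: supnorm_le => [|x]; first by rewrite addr_ge0// supnorm_ge0.
by rewrite (le_trans (ler_normD _ _))// lerD// supnorm_ub.
Qed.

Lemma bcnormZ (k : R) u : bcnorm (k *: u) = `|k| * bcnorm u.
Proof.
have le_normZ (l : R) v : bcnorm (l *: v) <= `|l| * bcnorm v.
  have [_ bv] := bcP v.
  apply: supnorm_le => [|x]; first by rewrite mulr_ge0// supnorm_ge0.
  by rewrite /= normrZ ler_wpM2l// supnorm_ub.
apply/eqP; rewrite eq_le le_normZ /=.
have [->|k0] := eqVneq k 0.
  by rewrite normr0 mul0r supnorm_ge0//; have [] := bcP (0 *: u).
rewrite -ler_pdivlMl ?normr_gt0// -normfV.
by rewrite -[leLHS]/(bcnorm u) -{1}[u](scalerK k0) le_normZ.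
Qed.

Lemma bcnorm0_eq0 u : bcnorm u = 0 -> u = 0.
Proof.
move=> u0; apply/val_inj/funext => x; have [_ bu] := bcP u.
by apply/normr0_eq0/le_anti; rewrite normr_ge0 andbT -u0 supnorm_ub.
Qed.

HB.instance Definition _ :=
  Lmodule_isNormed.Build R (BC T V) bcnormD bcnormZ bcnorm0_eq0.

Definition toBC (f : T -> V) : BC T V := insubd (0 : BC T V) f.

End bc_normed.

Section operators.
Context {R : realType} {V W : normedModType R}.

Definition bounded_op (L : V -> W) : Prop :=
  exists M : R, forall v, `|L v| <= M * `|v|.

(* Extended-real valued, so that an unbounded L has norm +oo. *)
Definition opnorm (L : V -> W) : \bar R :=
  ereal_sup [set `|L v|%:E | v in [set v | `|v| <= 1]].

End operators.

Section dimension.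
Context {R : realType} {V : lmodType R}.

Definition has_dim (S : set V) (d : nat) : Prop :=
  exists e : 'I_d -> V,
    (forall c : 'I_d -> R, \sum_i c i *: e i = 0 -> forall i, c i = 0) /\
    S = [set \sum_i c i *: e i | c in [set: 'I_d -> R]].

(* The classes of the e i form a basis of the quotient V / S. *)
Definition has_codim (S : set V) (d : nat) : Prop :=
  exists e : 'I_d -> V,
    (forall c : 'I_d -> R, S (\sum_i c i *: e i) -> forall i, c i = 0) /\
    (forall v, exists c : 'I_d -> R, S (v - \sum_i c i *: e i)).

End dimension.

Section strip.
Context {R : realType}.

Definition I01 : Type := set_type (`[0, 1]%classic : set R).

Lemma I01_0 : (0 : R) \in (`[0, 1]%classic : set R).
Proof. by rewrite inE /= in_itv /= lexx ler01. Qed.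
Lemma I01_1 : (1 : R) \in (`[0, 1]%classic : set R).
Proof. by rewrite inE /= in_itv /= lexx ler01. Qed.

Definition zero01 : I01 := exist _ 0 I01_0.
Definition one01 : I01 := exist _ 1 I01_1.

Definition to01 (s : R) : I01 := insubd zero01 s.

(* x^' lives in the subspace [0, 1]: the derivative is one-sided at 0 and 1. *)
Definition diffquot01 {V : normedModType R} (f : I01 -> V) (x y : I01) : V :=
  (val y - val x)^-1 *: (f y - f x).

Definition is_deriv01 {V : normedModType R} (f : I01 -> V) (x : I01) (l : V) :=
  diffquot01 f x @ x^' --> l.

Definition derivable01 {V : normedModType R} (f : I01 -> V) (x : I01) : Prop :=
  cvg (diffquot01 f x @ x^').

Definition deriv01 {V : normedModType R} (f : I01 -> V) (x : I01) : V :=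
  lim (diffquot01 f x @ x^').

(* Oriented integral from x to y; to01 is the identity on the range of s. *)
Definition int01 (x y : I01) (g : I01 -> R) : R :=
  let h (s : R) := g (to01 s) in
  if val x <= val y
  then \int[lebesgue_measure]_(s in `[val x, val y]) h s
  else - \int[lebesgue_measure]_(s in `[val y, val x]) h s.

Definition strip : Type := (I01 * R)%type.

Section C1.
Context {V : normedModType R}.

Definition dx (u : strip -> V) (p : strip) : V :=
  deriv01 (fun x => u (x, p.2)) p.1.

Definition dt (u : strip -> V) (p : strip) : V :=
  derive1 (fun s : R => u (p.1, s)) p.2.

Definition BC1 (u : strip -> V) : Prop :=
  [/\ bounded_continuous u,
      forall p, derivable01 (fun x => u (x, p.2)) p.1,
      forall p, derivable (fun s : R => u (p.1, s)) p.2 1,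
      bounded_continuous (dx u) & bounded_continuous (dt u)].

Definition norm1 (u : strip -> V) : R :=
  supnorm u + supnorm (dx u) + supnorm (dt u).

Definition BC1R (v : R -> V) : Prop :=
  [/\ bounded_continuous v, forall t, derivable v t 1 &
      bounded_continuous (derive1 v)].

Definition norm1R (v : R -> V) : R := supnorm v + supnorm (derive1 v).

End C1.
End strip.
Arguments I01 : clear implicits.
Arguments strip : clear implicits.

Section system.
Context {R : realType} {n : nat} (m : nat).
Variables (a : 'I_n -> strip R -> R) (b : 'I_n -> 'I_n -> strip R -> R).
Variable Rb : BC (strip R) 'rV[R]_n -> BC R 'rV[R]_n.
Implicit Types (j k : 'I_n) (x xi eta : I01 R) (t : R).

(* The global solution exists and is unique by Picard-Lindelof when 1 / a j is
   bounded and Lipschitz in t; xget selects it. *)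
Definition omega j x t : I01 R -> R :=
  xget (cst t) [set w : I01 R -> R | w x = t /\
    forall xi, is_deriv01 (w : I01 R -> R^o) xi (a j (xi, w xi))^-1].

Definition cc j xi x t : R :=
  expR (int01 x xi (fun eta => let p := (eta, omega j x t eta) in
                               b j j p / a j p)).

Definition dd j xi x t : R := cc j xi x t / a j (xi, omega j x t xi).

(* Indices start at 0, so that 1 <= j <= m becomes j < m. *)
Definition xbd j : I01 R := if (j < m)%N then zero01 else one01.

Definition bdterm (u : BC (strip R) 'rV[R]_n) (p : strip R) j : R :=
  let: (x, t) := p in
  cc j (xbd j) x t * Rb u (omega j x t (xbd j)) ord0 j.

(* toBC returns 0 on maps that are not bounded and continuous. *)
Definition Cop (v : BC (strip R) 'rV[R]_n) : BC (strip R) 'rV[R]_n :=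
  toBC (fun p => \row_j bdterm v p j).

Definition bc_solution (f u : BC (strip R) 'rV[R]_n) : Prop :=
  forall j x t,
    let z xi := (xi, omega j x t xi) in
    u (x, t) ord0 j =
      bdterm u (x, t) j
      - int01 (xbd j) x (fun xi =>
          dd j xi x t * \sum_(k < n | k != j) b j k (z xi) * u (z xi) ord0 k)
      + int01 (xbd j) x (fun xi => dd j xi x t * f (z xi) ord0 j).

End system.

(* Main.v *)
(* Write C for the boundary operator, B u for the vector of the
   - sum_(k != j) b_jk u_k, and F f for the integral of d_j f_j along the
   characteristics, so that u is a bounded continuous solution for f iff
   u = C u + F (B u + f). Since a power of C is a contraction, 1 - C is
   invertible; with g = B u + f and T = B (1 - C)^-1 F the equation becomes
   g - T g = f, and it remains to prove that 1 - T is Fredholm of index 0.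

   The operator F B (1 - C)^-1 F is a norm limit of operators of finite rank,
   hence so is T^2. Indeed v = (1 - C)^-1 F f is, up to a fixed factor,
   transported along the k-characteristics with a source of size O(|f|), and
   (F B v)_j integrates b_jk v_k = bt_jk (a_k - a_j) v_k along
   j-characteristics; the factor a_k - a_j turns the integrand into a total
   derivative up to a continuous weight, so that F B v is equicontinuous, with a
   bound that is linear in f. The decay of the b_jk makes F B v small for large
   |t|, uniformly in f, and a partition of unity yields the finite rank
   approximation.

   Finally, (1 + T / k)^k (1 - T) = 1 - T^2 r(T) with 1 + T / k invertible for
   large k, so 1 - T equals, up to an invertible factor, the identity minus an
   operator E L of finite rank, whose kernel and cokernel are those of the square
   matrix 1 - L E. *)
From HB Require Import structures.
Require Import Defs.
From mathcomp Require Import all_boot all_order all_algebra.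
From mathcomp Require Import all_classical all_reals all_analysis.
From mathcomp Require Import ring lra.

Set Implicit Arguments.
Unset Strict Implicit.
Unset Printing Implicit Defensive.

Import Order.TTheory GRing.Theory Num.Theory.
Import numFieldNormedType.Exports.

Local Open Scope classical_set_scope.
Local Open Scope ring_scope.

(** * Oriented integrals of continuous functions *)

(** [T] itself cannot be expected to be a limit of finite rank operators: [F] integrates the source
    f_k along its own characteristics and leaves its dependence on their label as rough as it was,
    and the boundary operator is nonlocal and smooths nothing. Smoothing occurs only when a
    j-characteristic crosses the k-characteristics with k different from j, hence the square. Where
    the two families are tangent, b_jk vanishes along with a_k - a_j, so crossings need not be
    transversal.

    The functions v involved are merely continuous and are never differentiated.

    All calculus takes place on the real line: data on the strip are extended constantly in x beyond
    [0, 1], which makes the characteristics global flows. *)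

Section oriented_integral.
Context {R : realType}.
Implicit Types (x y z : R) (f g h : R -> R).

Lemma is_derive0_cst f : (forall x, is_derive x (1 : R) f 0) ->
  forall x y, f x = f y.
Proof. by move=> f0 x y; apply: is_derive_0_is_cst. Qed.

(** Mirrors [int01] with real end points, so that [int01] unfolds to it in [int01E]. *)
Definition oint x y h : R :=
  if x <= y then \int[lebesgue_measure]_(s in `[x, y]) h s
  else - \int[lebesgue_measure]_(s in `[y, x]) h s.

Lemma eq_oint x y g h :
  (forall s, Num.min x y <= s <= Num.max x y -> g s = h s) ->
  oint x y g = oint x y h.
Proof.
move=> gh; rewrite /oint; case: ifPn => xy.
  apply: eq_Rintegral => s; rewrite inE/= in_itv/= => /andP[xs sy].
  by apply: gh; rewrite ge_min le_max xs sy orbT.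
congr (- _); apply: eq_Rintegral => s; rewrite inE/= in_itv/= => /andP[xs sy].
by apply: gh; rewrite ge_min le_max xs sy orbT.
Qed.

Lemma ointxx x h : oint x x h = 0.
Proof. by rewrite /oint lexx set_itv1 Rintegral_set1. Qed.

Lemma ointC x y h : oint y x h = - oint x y h.
Proof.
rewrite /oint; case: (ltgtP x y) => [//|_|->]; first by rewrite opprK.
by rewrite set_itv1 Rintegral_set1 oppr0.
Qed.

Lemma continuous_itv_integrable x y h : continuous h ->
  lebesgue_measure.-integrable `[x, y] (EFin \o h).
Proof.
move=> ch; apply: (@continuous_compact_integrable R h); first exact: segment_compact.
exact: continuous_subspaceT.
Qed.

Lemma oint_cat x y z h : continuous h -> oint x y h + oint y z h = oint x z h.
Proof.
move=> ch.
have H a b c : a <= b -> b <= c -> oint a b h + oint b c h = oint a c h.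
  move=> ab bc; rewrite /oint ab bc (le_trans ab bc).
  have := @Rintegral_itvB R h (BLeft a) (BRight c) b
    (continuous_itv_integrable a c ch).
  rewrite !bnd_simp => /(_ ab bc) /eqP.
  rewrite Rintegral_itv_obnd_cbnd; last first.
    apply: (integrableS _ _ _ (continuous_itv_integrable b c ch)) => //.
    by apply: subset_itvr; rewrite bnd_simp.
  by rewrite subr_eq addrC => /eqP <-.
have [xy|/ltW yx] := leP x y; have [yz|/ltW zy] := leP y z.
- exact: H.
- have [xz|/ltW zx] := leP x z.
    by rewrite -(H x z y)// (ointC z y) addrK.
  by rewrite (ointC z x) (ointC z y) -(H z x y)// opprD addrCA subrr addr0.
- have [xz|/ltW zx] := leP x z.
    by rewrite -(H y x z)// (ointC y x) addKr.
  by rewrite (ointC z x) (ointC y x) -(H y z x)// opprD addrAC addNr add0r.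
- by rewrite (ointC z x) (ointC y x) (ointC z y) -(H z y x)// opprD addrC.
Qed.

Lemma is_derive_oint x y h : continuous h ->
  is_derive y (1 : R) (fun y => oint x y h) (h y).
Proof.
move=> ch.
(* With base point [y - 1] the oriented integral is an ordinary one for upper limits near [y], as
   [continuous_FTC1] requires; [oint_cat] then restores the base point [x]. *)
have yy1 : y - 1 < y by rewrite gtrBl.
have yy2 : y < y + 1 by rewrite ltrDl.
have := @continuous_FTC1 R h (BLeft (y - 1)) y (y + 1) yy2
  (continuous_itv_integrable _ _ ch).
move=> /= /(_ _ (ch y)).
rewrite lte_fin => /(_ yy1) [dF F'].
have D : is_derive y (1 : R)
    (fun x => \int[lebesgue_measure]_(t in `[y - 1, x]) h t) (h y).
  by apply: DeriveDef dF _; rewrite -derive1E F'.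
have {}D : is_derive y (1 : R) (fun z => oint (y - 1) z h) (h y).
  apply: near_eq_is_derive D; near=> z.
  have yz : y - 1 <= z by apply: ltW; near: z; exact: lt_nbhsr.
  by rewrite /oint yz.
have -> : (fun z => oint x z h) = (cst (oint x (y - 1) h)) + (fun z => oint (y - 1) z h).
  by apply/funext => z; rewrite fctE (oint_cat _ _ _ ch).
by rewrite -[h y]add0r; apply: is_deriveD.
Unshelve. all: by end_near. Qed.

Lemma oint_FTC x y F h : continuous h ->
  (forall x, is_derive x (1 : R) F (h x)) -> oint x y h = F y - F x.
Proof.
move=> ch dF.
have d0 z : is_derive z (1 : R) (F - (fun z => oint x z h)) 0.
  by rewrite -(subrr (h z)); apply: is_deriveB => //; exact: is_derive_oint.
have := is_derive0_cst d0 x y.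
by rewrite !fctE ointxx subr0 => ->; rewrite opprB addrC subrK.
Qed.

(** The right-hand side, as a function of [y], is a primitive of the integrand on the left. The same
    argument gives [ointZ]. *)
Lemma ointD x y g h : continuous g -> continuous h ->
  oint x y (fun s => g s + h s) = oint x y g + oint x y h.
Proof.
move=> cg ch.
have c : continuous (fun s => g s + h s) by move=> s; apply: cvgD; [exact: cg|exact: ch].
have d s : is_derive s (1 : R) ((fun y => oint x y g) + (fun y => oint x y h)) (g s + h s).
  by apply: is_deriveD; exact: is_derive_oint.
by rewrite (oint_FTC x y c d) !fctE !ointxx addr0 subr0.
Qed.

Lemma ointZ x y k h : continuous h ->
  oint x y (fun s => k * h s) = k * oint x y h.
Proof.
move=> ch.
have c : continuous (fun s => k * h s) by move=> s; apply: cvgM; [exact: cvg_cst|exact: ch].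
have d s : is_derive s (1 : R) (k *: (fun y => oint x y h)) (k * h s).
  by have := is_derive_oint x s ch => D; exact: is_deriveZ.
by rewrite (oint_FTC x y c d) !fctE !ointxx scaler0 subr0.
Qed.

Lemma ointB x y g h : continuous g -> continuous h ->
  oint x y (fun s => g s - h s) = oint x y g - oint x y h.
Proof.
move=> cg ch; rewrite -mulN1r -ointZ// -ointD//; last first.
  by move=> s; apply: cvgM; [exact: cvg_cst|exact: ch].
by congr oint; apply/funext => s; rewrite mulN1r.
Qed.

Lemma is_derive_continuous f (df : R -> R) :
  (forall x, is_derive x (1 : R) f (df x)) -> continuous f.
Proof.
by move=> d x; apply/differentiable_continuous/derivable1_diffP; case: (d x).
Qed.

Lemma ler_is_derive f (df : R -> R) x y :
  (forall x, is_derive x (1 : R) f (df x)) -> x <= y ->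
  (forall z, x <= z <= y -> 0 <= df z) -> f x <= f y.
Proof.
move=> d xy p.
have cf : {within `[x, y], continuous f}.
  by apply: continuous_subspaceT; exact: is_derive_continuous d.
have [z + E] := MVT_segment xy (fun z _ => d z) cf.
rewrite in_itv/= => zi; rewrite -subr_ge0 E mulr_ge0 ?subr_ge0//; exact: p.
Qed.

(** Both [g - f] and [g + f] are nondecreasing. Applied to primitives, this bounds integrals, by a
    linear [g] in [oint_bound] and by an exponential one in [oint_exp_bound]. *)
Lemma ler_norm_is_derive f g (df dg : R -> R) x y :
  (forall x, is_derive x (1 : R) f (df x)) ->
  (forall x, is_derive x (1 : R) g (dg x)) -> x <= y ->
  (forall z, x <= z <= y -> `|df z| <= dg z) -> `|f y - f x| <= g y - g x.
Proof.
move=> d1 d2 xy p.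
have H1 : (g - f) x <= (g - f) y.
  apply: (@ler_is_derive _ (fun z => dg z - df z)) => // z zi.
  rewrite subr_ge0; exact: le_trans (ler_norm _) (p _ zi).
have H2 : (g + f) x <= (g + f) y.
  apply: (@ler_is_derive _ (fun z => dg z + df z)) => // z zi.
  have := p _ zi; rewrite ler_norml => /andP[+ _]; lra.
move: H1 H2; rewrite !fctE => H1 H2; rewrite ler_norml; apply/andP; split; lra.
Qed.

Lemma oint_bound x y h M : continuous h ->
  (forall s, Num.min x y <= s <= Num.max x y -> `|h s| <= M) ->
  `|oint x y h| <= M * `|y - x|.
Proof.
move=> ch; wlog xy : x y / x <= y.
  move=> W; case/orP: (le_total x y) => [xy|yx]; first exact: W.
  move=> hM; rewrite ointC normrN distrC; apply: W => // s.
  by rewrite minC maxC; exact: hM.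
rewrite min_l// max_r// => hM.
have := @ler_norm_is_derive (fun y => oint x y h) (M *: id) h (fun=> M) x y.
rewrite ointxx subr0 [`|y - x|]ger0_norm ?subr_ge0// mulrBr; apply => // z.
  exact: is_derive_oint.
rewrite -[X in is_derive _ _ _ X]mulr1; exact: is_deriveZ.
Qed.

End oriented_integral.

(** * Integrals depending on a parameter *)

Section parametric.
Context {R : realType} {Q : topologicalType}.

(** Tube lemma for the compact segment [[x, y]]. *)
Lemma near_segment (P : R -> Q -> Prop) (x y : R) (q0 : Q) :
  (forall s, x <= s <= y -> \forall s' \near s & q \near q0, P s' q) ->
  \forall q \near q0, forall s, x <= s <= y -> P s q.
Proof.
move=> H.
have /compact_near_coveringP C := @segment_compact R x y.
have := C Q (nbhs q0) (fun q s => P s q) (nbhs_filter q0).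
move=> D; apply: filterS (D _) => [q sub s si|s].
  by apply: sub; rewrite /= in_itv.
by rewrite /= in_itv/=; exact: H.
Qed.

Lemma near_segment_dist (V : normedModType R) (h : R * Q -> V) (x y : R) (q0 : Q) (e : R) :
  continuous h -> 0 < e ->
  \forall q \near q0, forall s, x <= s <= y -> `|h (s, q) - h (s, q0)| <= e.
Proof.
move=> ch e0; apply: near_segment => s _.
have e20 : 0 < e / 2 by rewrite divr_gt0.
have /cvgrPdist_le /(_ _ e20) := ch (s, q0).
move=> [[A B] /= [nA nB] AB].
have [C1 C2] : nbhs q0 B /\ B q0 by split=> //; exact: nbhs_singleton.
exists (A, B) => // -[s' q] /= [As Bq].
have := AB (s', q) (conj As Bq); have := AB (s', q0) (conj As C2) => /=.
move=> h1 h2.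
have -> : h (s', q) - h (s', q0) = (h (s, q0) - h (s', q0)) - (h (s, q0) - h (s', q)).
  by rewrite opprB [RHS]addrC subrKA.
by rewrite (le_trans (ler_normB _ _))// [leRHS](splitr e) lerD.
Qed.

Lemma oint_continuous (h : R * Q -> R) : continuous h ->
  continuous (fun p : R * R * Q => oint p.1.1 p.1.2 (fun s => h (s, p.2))).
Proof.
move=> ch [[x y] q0] /=.
have cq q : continuous (fun s => h (s, q)).
  move=> s; apply: (cvg_comp (fun s => (s, q)) h) (ch (s, q)).
  exact: cvg_pair cvg_id (cvg_cst _).
pose H u := oint 0 u (fun s => h (s, q0)).
have cH : continuous H.
  by apply: is_derive_continuous => u; apply: is_derive_oint.
(* End points close to [x] and [y] stay in [[a, b]], on which the integrands for [q] and [q0] are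
   uniformly close. *)
pose a := Num.min x y - 1; pose b := Num.max x y + 1.
have ab : a <= b.
  by rewrite /a /b; have := ge_min x x y; have := le_max x x y; rewrite lexx/=; lra.
apply/cvgrPdist_le => e e0.
have e1 : 0 < e / 3 / (b - a + 1).
  by rewrite divr_gt0// ?divr_gt0//; lra.
have e3 : 0 < e / 3 by rewrite divr_gt0.
(* The change of the parameter is separated from the change of the end points; these two end points
   and the parameter account for one third of [e] each. *)
have Hb (u v : R) q : oint u v (fun s => h (s, q)) =
    oint u v (fun s => h (s, q) - h (s, q0)) + (H v - H u).
  rewrite ointB// /H -[in RHS](oint_cat 0 u v (cq q0)).
  by rewrite [X in _ + X]addrAC subrr add0r subrK.
have nx : \forall u \near x, `|H x - H u| <= e / 3 /\ a <= u <= b.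
  have /cvgrPdist_le /(_ _ e3) n1 := cH x.
  near=> u; split; first by near: u.
  apply/andP; split; apply: ltW; near: u; [apply: lt_nbhsr|apply: lt_nbhsl].
    by rewrite /a; have := ge_min x x y; rewrite lexx/=; lra.
  by rewrite /b; have := le_max x x y; rewrite lexx/=; lra.
have ny : \forall u \near y, `|H y - H u| <= e / 3 /\ a <= u <= b.
  have /cvgrPdist_le /(_ _ e3) n1 := cH y.
  near=> u; split; first by near: u.
  apply/andP; split; apply: ltW; near: u; [apply: lt_nbhsr|apply: lt_nbhsl].
    by rewrite /a; have := ge_min y x y; rewrite lexx orbT/=; lra.
  by rewrite /b; have := le_max y x y; rewrite lexx orbT/=; lra.
have nq := near_segment_dist a b q0 ch e1.
have nxy : \forall u \near x & v \near y,
    (`|H x - H u| <= e / 3 /\ a <= u <= b) /\ (`|H y - H v| <= e / 3 /\ a <= v <= b).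
  by exists ([set u | `|H x - H u| <= e / 3 /\ a <= u <= b],
    [set v | `|H y - H v| <= e / 3 /\ a <= v <= b]) => // -[u v].
exists ([set p | (`|H x - H p.1| <= e / 3 /\ a <= p.1 <= b) /\
    (`|H y - H p.2| <= e / 3 /\ a <= p.2 <= b)],
    [set q | forall s, a <= s <= b -> `|h (s, q) - h (s, q0)| <= e / 3 / (b - a + 1)]).
  by split.
move=> [[u v] q] /= [[[h1 /andP[au ub]] [h2 /andP[av vb]]] h3].
rewrite (Hb u v q) (Hb x y q0).
rewrite (_ : (fun s => h (s, q0) - h (s, q0)) = (fun s => 0 * h (s, q0))); last first.
  by apply/funext => s; rewrite subrr mul0r.
rewrite ointZ// mul0r add0r.
have h4 : `|oint u v (fun s => h (s, q) - h (s, q0))| <= e / 3.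
  have c : continuous (fun s => h (s, q) - h (s, q0)).
    by move=> s; apply: cvgB; exact: cq.
  apply: le_trans (oint_bound c (M := e / 3 / (b - a + 1)) _) _.
    move=> s /andP[s1 s2]; apply: h3; apply/andP; split.
      by apply: le_trans s1; rewrite le_min au av.
    by apply: (le_trans s2); rewrite ge_max ub vb.
  have : `|v - u| <= b - a + 1 by rewrite ler_norml; apply/andP; split; move: au ub av vb; clear; lra.
  have ba : 0 < b - a + 1 by rewrite ltr_wpDl// subr_ge0.
  move=> /(ler_wpM2l (ltW e1)) /le_trans; apply.
  by rewrite divfK// gt_eqF.
move: h1 h2 h4; rewrite !ler_norml => /andP[h1 h1'] /andP[h2 h2'] /andP[h4 h4'].
by apply/andP; split; move: h1 h1' h2 h2' h4 h4'; clear; lra.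
Unshelve. all: by end_near. Qed.

End parametric.

(** * Completeness of BC *)

(** Completeness is kept as a proposition and packed into a structure only inside
    [contraction_fixpoint]. *)
Definition cauchy_complete {R : realType} (X : normedModType R) : Prop :=
  forall F : set_system X, ProperFilter F -> cauchy F -> cvg F.

Section bc_complete.
Context {R : realType} {T : topologicalType} {V : normedModType R}.
Implicit Types u v : BC T V.

Lemma bc_continuous u : continuous (u : T -> V).
Proof. by have [] := bcP u. Qed.

Lemma bc_addE u v p : (u + v) p = u p + v p. Proof. by []. Qed.
Lemma bc_subE u v p : (u - v) p = u p - v p. Proof. by []. Qed.
Lemma bc_scaleE (k : R) u p : (k *: u) p = k *: u p. Proof. by []. Qed.

Lemma bc_ext u v : (forall p, u p = v p) -> u = v.
Proof. by move=> uv; apply/val_inj/funext. Qed.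

Lemma bc_ler_norm u p : `|u p| <= `|u|.
Proof. by apply: supnorm_ub; have [] := bcP u. Qed.

Lemma bc_norm_le u M : 0 <= M -> (forall p, `|u p| <= M) -> `|u| <= M.
Proof. exact: supnorm_le. Qed.

Lemma toBCE (f : T -> V) : continuous f -> (exists M, forall p, `|f p| <= M) ->
  forall p, toBC f p = f p.
Proof.
move=> cf bf p; rewrite /toBC insubdK//; apply/bcfunP; split=> //.
exact/bounded_funE.
Qed.

End bc_complete.

Lemma bc_complete {R : realType} {T : topologicalType} {V : normedModType R} :
  cauchy_complete V -> cauchy_complete (BC T V).
Proof.
move=> V_complete F FF /cauchy_ballP cF.
have pcvg (p : T) : cvg ((fun u : BC T V => u p) @ F).
  apply: V_complete; apply/cauchy_ballP => e e0; rewrite near_map2.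
  have := cF e e0; apply: filterS => -[u v] /=.
  rewrite -!ball_normE /=; apply: le_lt_trans; exact: (bc_ler_norm (u - v)).
pose l (p : T) : V := lim ((fun u : BC T V => u p) @ F).
(* The Cauchy estimate is uniform in [p] and closed in its second function, so it passes to the
   pointwise limit. *)
have unif (e : R) : 0 < e -> \forall u \near F, forall p, `|l p - (u : BC T V) p| <= e.
  move=> e0; have := cF _ e0.
  move=> [[A B] /= [FA FB] AB].
  apply: filterS FA => u Au p; rewrite distrC.
  have clB : closed [set x | `|u p - x| <= e].
    have -> : [set x | `|u p - x| <= e] = (fun x : V => `|u p - x|) @^-1` [set y | y <= e].
      by [].
    apply: closed_comp; last exact: closed_le.
    by move=> x _; apply: cvg_norm; apply: cvgB; [exact: cvg_cst|exact: cvg_id].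
  apply: (closed_cvg _ clB _ _ (pcvg p)).
  apply: filterS FB => v Bv /=.
  have := AB (u, v) (conj Au Bv); rewrite /= -ball_normE /= => /ltW.
  by apply: le_trans; exact: (bc_ler_norm (u - v)).
have lbc : l \in @bcfun R T V.
  apply/bcfunP; split.
    move=> p; apply/cvgrPdist_le => e e0.
    have e30 : 0 < e / 3 by rewrite divr_gt0.
    have [u Hu] := @filter_ex _ F _ _ (unif _ e30).
    have /cvgrPdist_le /(_ _ e30) := @bc_continuous _ _ _ u p.
    apply: filterS => q Hq.
    have -> : l p - l q = (l p - u p) + (u p - u q) - (l q - u q).
      by rewrite opprB addrA subrKA subrK.
    have h1 := Hu p; have h2 := Hu q.
    rewrite (le_trans (ler_normB _ _))//.
    have := ler_normD (l p - u p) (u p - u q); move: h1 h2 Hq; lra.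
  have [u Hu] := @filter_ex _ F _ _ (unif 1 ltr01).
  apply/bounded_funE; exists (1 + `|u|) => p.
  rewrite -[l p](subrK (u p)) (le_trans (ler_normD _ _))// lerD//.
  exact: bc_ler_norm.
apply/cvg_ex; exists (MkBC lbc); apply/cvgrPdist_le => e e0.
have := unif _ e0; apply: filterS => u Hu.
by apply: bc_norm_le => //; exact: ltW.
Qed.

Lemma contraction_fixpoint {R : realType} {X : normedModType R}
    (f : X -> X) (q : R) : cauchy_complete X -> 0 <= q -> q < 1 ->
  (forall x y, `|f x - f y| <= q * `|x - y|) -> exists x, x = f x.
Proof.
move=> X_complete q0 q1 fq.
pose X' : completeNormedModType R := HB.pack X (Uniform_isComplete.Build X X_complete).
pose F : {fun [set: X'] >-> [set: X']} := HB.pack f (@isFun.Build X' X' setT setT f (fun _ _ => I)).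
have cF : is_contraction F.
  exists (NngNum q0); split=> //= -[x y] _; exact: fq.
have [x _ xE] := banach_fixed_point cF closedT (ex_intro _ 0 I).
by exists x.
Qed.

(** * Scalar ordinary differential equations *)

Lemma cont_comp {T U V : topologicalType} (F : U -> V) (k : T -> U) :
  continuous F -> continuous k -> continuous (fun x => F (k x)).
Proof. by move=> cF ck x; apply: (cvg_comp k F) (cF (k x)); exact: ck. Qed.

(** * Rules for continuity and derivatives *)

Section continuity_rules.
Context {R : realType} {T U V : topologicalType}.

Lemma cont_id : continuous (fun x : T => x).
Proof. by move=> x; exact: cvg_id. Qed.

Lemma cont_cst (c : U) : continuous (fun _ : T => c).
Proof. by move=> x; exact: cvg_cst. Qed.

Lemma cont_pair (f : T -> U) (g : T -> V) : continuous f -> continuous g ->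
  continuous (fun x => (f x, g x)).
Proof. by move=> cf cg x; apply: cvg_pair; [exact: cf|exact: cg]. Qed.

Lemma cont_fst (f : T -> U * V) : continuous f -> continuous (fun x => (f x).1).
Proof. by move=> cf; apply: cont_comp cf => x; exact: cvg_fst. Qed.

Lemma cont_snd (f : T -> U * V) : continuous f -> continuous (fun x => (f x).2).
Proof. by move=> cf; apply: cont_comp cf => x; exact: cvg_snd. Qed.

Implicit Types f g : T -> R.

Lemma cont_add f g : continuous f -> continuous g -> continuous (fun x => f x + g x).
Proof. by move=> cf cg x; apply: cvgD; [exact: cf|exact: cg]. Qed.

Lemma cont_opp f : continuous f -> continuous (fun x => - f x).
Proof. by move=> cf x; apply: cvgN; exact: cf. Qed.

Lemma cont_mul f g : continuous f -> continuous g -> continuous (fun x => f x * g x).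
Proof. by move=> cf cg x; apply: cvgM; [exact: cf|exact: cg]. Qed.

Lemma cont_norm f : continuous f -> continuous (fun x => `|f x|).
Proof. by move=> cf x; apply: cvg_norm; exact: cf. Qed.

Lemma cont_inv f : (forall x, f x != 0) -> continuous f -> continuous (fun x => (f x)^-1).
Proof. by move=> f0 cf x; apply: cvgV => //; exact: cf. Qed.

End continuity_rules.

Lemma cont_max {R : realType} {T : topologicalType} (f g : T -> R) :
  continuous f -> continuous g -> continuous (fun x => Num.max (f x) (g x)).
Proof. by move=> cf cg x; apply: (@continuous_max R T f g x); [exact: cf|exact: cg]. Qed.

Lemma cont_min {R : realType} {T : topologicalType} (f g : T -> R) :
  continuous f -> continuous g -> continuous (fun x => Num.min (f x) (g x)).
Proof. by move=> cf cg x; apply: (@continuous_min R T f g x); [exact: cf|exact: cg]. Qed.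

Lemma cont_exp {R : realType} {T : topologicalType} (f : T -> R) :
  continuous f -> continuous (fun x => expR (f x)).
Proof. by move=> cf; apply: (cont_comp (@continuous_expR R)). Qed.

Lemma cont_oint {R : realType} {T : topologicalType} (h : R * T -> R) (f g : T -> R) :
  continuous h -> continuous f -> continuous g ->
  continuous (fun x => oint (f x) (g x) (fun s => h (s, x))).
Proof.
move=> ch cf cg.
have := cont_comp (oint_continuous ch) (cont_pair (cont_pair cf cg) (@cont_id T)).
exact.
Qed.

(** Functions are recognised only when their continuity is a hypothesis about a variable or local
    definition; this is why proofs name functions and restate goals in expanded form before calling
    [cont]. *)
Ltac cont1 := match goal with
  | H : continuous ?F |- continuous ?F => exact H
  | |- continuous (fun x => x) => exact: cont_id
  | |- continuous (fun _ => ?c) => exact: cont_cst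
  | |- continuous (fun x => (@?f x, @?g x)) => apply (@cont_pair _ _ _ f g)
  | |- continuous (fun x => (@?f x).1) => apply (@cont_fst _ _ _ f)
  | |- continuous (fun x => (@?f x).2) => apply (@cont_snd _ _ _ f)
  | |- continuous (fun x => (@?f x) + (@?g x)) => apply (@cont_add _ _ f g)
  | |- continuous (fun x => - (@?f x)) => apply (@cont_opp _ _ f)
  | |- continuous (fun x => (@?f x) * (@?g x)) => apply (@cont_mul _ _ f g)
  | |- continuous (fun x => `|@?f x|) => apply (@cont_norm _ _ f)
  | |- continuous (fun x => expR (@?f x)) => apply (@cont_exp _ _ f)
  | |- continuous (fun x => Num.max (@?f x) (@?g x)) => apply (@cont_max _ _ f g)
  | |- continuous (fun x => Num.min (@?f x) (@?g x)) => apply (@cont_min _ _ f g)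
  | H : continuous ?F |- continuous (fun x => ?F (@?k x)) =>
      apply (@cont_comp _ _ _ F k H)
  end.
Ltac cont := repeat (cbv beta; cont1).

Lemma is_derive_affine {R : realType} (a c x : R) :
  is_derive x (1 : R) (fun x => a + x * c) c.
Proof.
have -> : (fun x : R => a + x * c) = cst a + (c *: id).
  by apply/funext => y; rewrite !fctE mulrC.
have : is_derive x (1 : R) (cst a + c *: id) (0 + c *: 1) by apply: is_deriveD.
by rewrite add0r (_ : c *: 1 = c) //; exact: mulr1.
Qed.

Section derivation_rules.
Context {R : realType}.
Implicit Types (f g : R -> R) (x df dg : R).

Lemma derive_val f x df df' : is_derive x (1 : R) f df -> df = df' ->
  is_derive x (1 : R) f df'.
Proof. by move=> + <-. Qed.

Lemma derive_add f g x df dg : is_derive x (1 : R) f df ->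
  is_derive x (1 : R) g dg -> is_derive x (1 : R) (fun s => f s + g s) (df + dg).
Proof. exact: is_deriveD. Qed.

Lemma derive_sub f g x df dg : is_derive x (1 : R) f df ->
  is_derive x (1 : R) g dg -> is_derive x (1 : R) (fun s => f s - g s) (df - dg).
Proof. exact: is_deriveB. Qed.

Lemma derive_opp f x df : is_derive x (1 : R) f df ->
  is_derive x (1 : R) (fun s => - f s) (- df).
Proof. exact: is_deriveN. Qed.

Lemma derive_mul f g x df dg : is_derive x (1 : R) f df ->
  is_derive x (1 : R) g dg ->
  is_derive x (1 : R) (fun s => f s * g s) (f x * dg + g x * df).
Proof. exact: is_deriveM. Qed.

Lemma derive_exp f x df : is_derive x (1 : R) f df ->
  is_derive x (1 : R) (fun s => expR (f s)) (expR (f x) * df).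
Proof. exact: (is_derive1_comp (is_derive_expR _)). Qed.

End derivation_rules.

Section ode.
Context {R : realType} (g dg : R * R -> R) (G L : R).
Hypothesis cg : continuous g.
Hypothesis cdg : continuous dg.
Hypothesis dgE : forall x s, is_derive s (1 : R) (fun s => g (x, s)) (dg (x, s)).
Hypothesis gG : forall p, `|g p| <= G.
Hypothesis dgL : forall p, `|dg p| <= L.

(* Hadamard's form of the divided difference of g in its second variable. *)
Definition gdiff (p : R * R * R) : R :=
  oint 0 1 (fun th => dg (p.1.1, p.2 + th * (p.1.2 - p.2))).

Lemma gdiff_continuous : continuous gdiff.
Proof.
have c : continuous (fun z : R * (R * R * R) =>
  dg (z.2.1.1, z.2.2 + z.1 * (z.2.1.2 - z.2.2))).
  cont.
exact: (@cont_oint R _ _ (fun=> 0) (fun=> 1) c (@cont_cst _ _ _) (@cont_cst _ _ _)).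
Qed.

Lemma gdiffE x y1 y2 : g (x, y1) - g (x, y2) = (y1 - y2) * gdiff (x, y1, y2).
Proof.
have c : continuous (fun th : R => dg (x, y2 + th * (y1 - y2))) by cont.
rewrite /gdiff /= -ointZ//.
have D th : is_derive th (1 : R) (fun th => g (x, y2 + th * (y1 - y2)))
    ((y1 - y2) * dg (x, y2 + th * (y1 - y2))).
  have D1 := is_derive_affine y2 (y1 - y2) th.
  have D2 := dgE x (y2 + th * (y1 - y2)).
  have := @is_derive1_comp _ (fun s => g (x, s)) (fun th : R => y2 + th * (y1 - y2)) th _ _ D2 D1.
  by rewrite mulrC.
rewrite (oint_FTC 0 1 _ D)//; last by cont.
by by rewrite mul0r mul1r addr0 (addrC y2) subrK.
Qed.

Lemma gdiff_bound p : `|gdiff p| <= L.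
Proof.
have := @oint_bound R 0 1 (fun th => dg (p.1.1, p.2 + th * (p.1.2 - p.2))) L.
by rewrite subr0 normr1 mulr1; apply => //; cont.
Qed.

(** The equation is imposed only inside []a, b[], so that a solution on [[0, 1]] extended by
    constants, with corners at 0 and 1, qualifies. *)
Definition solves (a b : R) (y : R -> R) := continuous y /\
  forall x, x \in `]a, b[ -> is_derive x (1 : R) y (g (x, y x)).

(* The difference of two solutions of a scalar equation solves a linear one. *)
Lemma solves_diff a b y1 y2 x z : solves a b y1 -> solves a b y2 ->
  x \in `[a, b] -> z \in `[a, b] ->
  y1 z - y2 z = (y1 x - y2 x) * expR (oint x z (fun s => gdiff (s, y1 s, y2 s))).
Proof.
move=> [c1 d1] [c2 d2] xab zab.
have gc := gdiff_continuous.
have : continuous (fun s => gdiff (s, y1 s, y2 s)) by cont.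
set q := (fun s => _); move=> cq.
have dq s := is_derive_oint x s cq.
have coq := is_derive_continuous dq.
(* Integrating factor: this product has derivative 0 inside []a, b[], and by continuity it is
   constant up to the end points. *)
have : continuous (fun s => (y1 s - y2 s) * expR (- (fun s => oint x s q) s)) by cont.
set E := (fun s => _); move=> cE.
have dE s : s \in `]a, b[ -> is_derive s (1 : R) E 0.
  move=> sab; have := d1 s sab; have := d2 s sab; have := dq s => D0 D2 D1.
  apply: derive_val (derive_mul (derive_sub D1 D2) (derive_exp (derive_opp D0))) _.
  by rewrite gdiffE /q; ring.
have Ecst u v : u \in `[a, b] -> v \in `[a, b] -> u <= v -> E u = E v.
  move=> uab vab uv.
  have dE' s : s \in `]u, v[ -> is_derive s (1 : R) E ((fun=> 0) s).
    move=> suv; apply: dE; move: suv uab vab; rewrite !in_itv/=.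
    move=> /andP[us sv] /andP[au ub] /andP[av vb].
    by rewrite (le_lt_trans au us) (lt_le_trans sv vb).
  have [w _ Ew] := MVT_segment uv dE' (continuous_subspaceT cE).
  by apply/esym/eqP; rewrite -subr_eq0 Ew mul0r.
have : E z = E x.
  by case/orP: (le_total x z) => xz; [apply/esym|]; exact: Ecst.
rewrite /E ointxx oppr0 expR0 mulr1 => <-.
by rewrite expRN divfK// gt_eqF// expR_gt0.
Qed.

End ode.

(** Integrating from [x] gains a factor [lam^-1] against the weight [expR (lam * |s - x|)]. For
    large [lam] this makes the Picard map a contraction on the whole line. *)
Lemma oint_exp_bound {R : realType} (h : R -> R) (x z M lam : R) :
  continuous h -> 0 < lam -> 0 <= M ->
  (forall s, `|h s| <= M * expR (lam * `|s - x|)) ->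
  `|oint x z h| <= M / lam * expR (lam * `|z - x|).
Proof.
move=> ch lam0 M0 hM; have Ml : 0 <= M / lam by rewrite divr_ge0// ltW.
case/orP: (le_total x z) => xz.
  have D s : is_derive s (1 : R) (fun s => (M / lam) * expR (- lam * x + s * lam))
      (M * expR (- lam * x + s * lam)).
    apply: derive_val (derive_mul (is_derive_cst _ _ _)
      (derive_exp (is_derive_affine (- lam * x) lam s))) _.
    by rewrite mulr0 addr0 mulrCA divfK ?gt_eqF// mulrC.
  have H := @ler_norm_is_derive _ _ _ _ _ x z (fun s => is_derive_oint x s ch) D xz.
  rewrite ointxx subr0 in H; have -> : `|z - x| = z - x by rewrite ger0_norm ?subr_ge0.
  rewrite mulrBr.
  apply: le_trans (H _) _.
    move=> s /andP[xs _]; apply: le_trans (hM s) _.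
    have -> : `|s - x| = s - x by rewrite ger0_norm ?subr_ge0.
    by rewrite mulrBr addrC mulNr (mulrC s).
  have -> : - lam * x + z * lam = lam * z - lam * x by ring.
  rewrite lerBlDr lerDl.
  by rewrite mulr_ge0// expR_ge0.
have D s : is_derive s (1 : R) (fun s => - (M / lam) * expR (lam * x + s * - lam))
    (M * expR (lam * x + s * - lam)).
  apply: derive_val (derive_mul (is_derive_cst _ _ _)
    (derive_exp (is_derive_affine (lam * x) (- lam) s))) _.
  by rewrite mulr0 addr0 mulrCA mulrNN divfK ?gt_eqF// mulrC.
have H := @ler_norm_is_derive _ _ _ _ _ z x (fun s => is_derive_oint x s ch) D xz.
rewrite ointxx sub0r normrN in H; have -> : `|z - x| = x - z by rewrite ler0_norm ?subr_le0// opprB.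
rewrite mulrBr.
apply: le_trans (H _) _.
  move=> s /andP[_ sx]; apply: le_trans (hM s) _.
  have -> : `|s - x| = x - s by rewrite ler0_norm ?subr_le0// opprB.
  by rewrite mulrBr mulrN (mulrC s).
have -> : lam * x + z * - lam = lam * x - lam * z by ring.
rewrite !mulNr opprK addrC lerBlDr lerDl.
by rewrite mulr_ge0// expR_ge0.
Qed.

(** * The flow of a scalar equation *)

Section flow.
Context {R : realType} (g dg : R * R -> R) (G L : R).
Hypothesis cg : continuous g.
Hypothesis cdg : continuous dg.
Hypothesis dgE : forall x s, is_derive s (1 : R) (fun s => g (x, s)) (dg (x, s)).
Hypothesis gG : forall p, `|g p| <= G.
Hypothesis dgL : forall p, `|dg p| <= L.

Let L0 : 0 <= L. Proof. exact: le_trans (normr_ge0 _) (dgL 0). Qed.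
Let G0 : 0 <= G. Proof. exact: le_trans (normr_ge0 _) (gG 0). Qed.

Lemma g_lip x s1 s2 : `|g (x, s1) - g (x, s2)| <= L * `|s1 - s2|.
Proof.
by rewrite (gdiffE cdg dgE) normrM mulrC ler_wpM2r// (gdiff_bound cdg dgL).
Qed.

(* Picard iteration in the norm weighted by exp (- (L + 1) |z - x|). *)
Lemma picard (x t : R) : exists y : R -> R,
  y x = t /\ forall z, is_derive z (1 : R) y (g (z, y z)).
Proof.
pose lam := L + 1; have lam0 : 0 < lam by rewrite ltr_wpDl.
pose w (s : R) := expR (lam * `|s - x|).
have cw : continuous w.
  have : continuous (fun s => expR (lam * `|s - x|)) by cont.
  exact.
have w0 s : 0 < w s by exact: expR_gt0.
pose w' (s : R) := expR (- (lam * `|s - x|)).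
have cw' : continuous w'.
  have : continuous (fun s => expR (- (lam * `|s - x|))) by cont.
  exact.
have ww' s : w' s * w s = 1 by rewrite /w /w' -expRD addNr expR0.
have w'0 s : 0 <= w' s by exact: expR_ge0.
have ch (z : BC R R) : continuous (fun s => g (s, t + w s * z s)).
  by have cz := @bc_continuous _ _ _ z; cont.
(* The unknown is [z] in [y = t + w * z], so that the fixed point can be sought among bounded
   functions. The contraction factor is [L / (L + 1)]. *)
pose K0 (z : BC R R) (s : R) : R := w' s * oint x s (fun s => g (s, t + w s * z s)).
have cK z : continuous (K0 z).
  have c := is_derive_continuous (fun s => is_derive_oint x s (ch z)).
  have : continuous (fun s => w' s * (fun s => oint x s (fun s => g (s, t + w s * z s))) s).
    by cont.
  exact.
have bK z : exists M, forall s, `|K0 z s| <= M.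
  exists (G / lam) => s; rewrite normrM (ger0_norm (w'0 s)).
  have h1 := @oint_exp_bound _ _ x s G lam (ch z) lam0 G0.
  apply: le_trans (ler_wpM2l (w'0 s) (h1 _)) _.
    move=> u; apply: le_trans (gG _) _; rewrite ler_peMr//.
    by rewrite -expR0 ler_expR mulr_ge0// ltW.
  by rewrite mulrCA -/(w s) ww' mulr1.
pose K (z : BC R R) : BC R R := toBC (K0 z).
have [] := @contraction_fixpoint R _ K (L / lam) (bc_complete (@R_complete R : cauchy_complete R)).
- by rewrite divr_ge0// ltW.
- by rewrite ltr_pdivrMr// mul1r ltrDl.
- move=> z1 z2; apply: bc_norm_le => [|s].
    by rewrite mulr_ge0// divr_ge0// ltW.
  rewrite bc_subE /K !toBCE//; rewrite /K0 -mulrBr -ointB//.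
  rewrite normrM (ger0_norm (w'0 s)).
  have c : continuous (fun s => g (s, t + w s * z1 s) - g (s, t + w s * z2 s)).
    by move=> u; apply: cvgB; exact: ch.
  have h1 := @oint_exp_bound _ _ x s (L * `|z1 - z2|) lam c lam0.
  apply: le_trans (ler_wpM2l (w'0 s) (h1 _ _)) _.
  + by rewrite mulr_ge0.
  + move=> u; apply: le_trans (g_lip _ _ _) _.
    rewrite opprD addrACA subrr add0r -mulrBr normrM (gtr0_norm (w0 u)).
    rewrite -mulrA ler_wpM2l// mulrC ler_wpM2r ?(ltW (w0 u))//.
    exact: (bc_ler_norm (z1 - z2)).
  by rewrite mulrCA -/(w s) ww' mulr1 mulrAC.
move=> z zE.
have yE s : t + w s * z s = t + oint x s (fun s => g (s, t + w s * z s)).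
  by rewrite {1}zE /K toBCE// /K0 mulrA (mulrC (w s)) ww' mul1r.
exists (fun s => t + w s * z s); split.
  by rewrite yE ointxx addr0.
move=> s; have := derive_add (is_derive_cst t s (1 : R)) (is_derive_oint x s (ch z)).
rewrite add0r (_ : (fun s0 => t + _) = fun s => t + w s * z s)//.
by apply/funext => u; rewrite yE.
Qed.

Lemma picard_choice : {phi : R * R * R -> R | forall x t,
  phi (x, x, t) = t /\
  forall z, is_derive z (1 : R) (fun z => phi (z, x, t)) (g (z, phi (z, x, t)))}.
Proof.
have [y yP] := choice (fun p : R * R => picard p.1 p.2).
exists (fun p => y (p.1.2, p.2) p.1.1) => x t.
exact: (yP (x, t)).
Qed.

(* flow (z, x, t) is the value at z of the solution through (x, t). *)
Definition flow : R * R * R -> R := sval picard_choice.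

Lemma flow_xx x t : flow (x, x, t) = t.
Proof. by have [] := svalP picard_choice x t. Qed.

Lemma flow_derive x t z :
  is_derive z (1 : R) (fun z => flow (z, x, t)) (g (z, flow (z, x, t))).
Proof. by have [_] := svalP picard_choice x t; exact. Qed.

Lemma flow_solves a b x t : solves g a b (fun z => flow (z, x, t)).
Proof.
split=> [|z _]; last exact: flow_derive.
exact: (is_derive_continuous (flow_derive x t)).
Qed.

Lemma flow_uniq a b y x z : solves g a b y -> x \in `[a, b] -> z \in `[a, b] ->
  y z = flow (z, x, y x).
Proof.
move=> sy xab zab; have := solves_diff cdg dgE sy (flow_solves a b x (y x)) xab zab.
by rewrite flow_xx subrr mul0r => /eqP; rewrite subr_eq0 => /eqP.
Qed.

Lemma flow_flow x y z t : flow (z, y, flow (y, x, t)) = flow (z, x, t).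
Proof.
pose a := Num.min y z; pose b := Num.max y z.
apply/esym; apply: (flow_uniq (flow_solves a b x t));
  by rewrite in_itv/= /a /b ge_min le_max lexx ?orbT.
Qed.

(* The integrand of the exponent of flow (z, x, s1) - flow (z, x, s2). *)
Definition flowq (p : R * (R * R * R)) : R :=
  gdiff dg (p.1, flow (p.1, p.2.1.1, p.2.1.2), flow (p.1, p.2.1.1, p.2.2)).

Lemma flow_diff z x s1 s2 : flow (z, x, s1) - flow (z, x, s2) =
  (s1 - s2) * expR (oint x z (fun s => flowq (s, (x, s1, s2)))).
Proof.
pose a := Num.min x z; pose b := Num.max x z.
have := solves_diff cdg dgE (flow_solves a b x s1) (flow_solves a b x s2) (x := x) (z := z).
by rewrite !flow_xx; apply; rewrite in_itv/= /a /b ge_min le_max lexx ?orbT.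
Qed.

Lemma flow_bound z x t : `|flow (z, x, t) - t| <= G * `|z - x|.
Proof.
have cf := is_derive_continuous (flow_derive x t).
have c : continuous (fun z => g (z, (fun z => flow (z, x, t)) z)) by cont.
have := oint_FTC x z c (flow_derive x t); rewrite flow_xx => <-.
exact: oint_bound.
Qed.

Lemma flow_lip z x s1 s2 :
  `|flow (z, x, s1) - flow (z, x, s2)| <= `|s1 - s2| * expR (L * `|z - x|).
Proof.
rewrite flow_diff normrM ler_wpM2l// gtr0_norm ?expR_gt0// ler_expR.
apply: le_trans (ler_norm _) _; apply: oint_bound => [|s _]; last first.
  exact: gdiff_bound.
have c1 := is_derive_continuous (flow_derive x s1).
have c2 := is_derive_continuous (flow_derive x s2).
have c3 := gdiff_continuous cdg.
have : continuous (fun s => gdiff dg (s, (fun z => flow (z, x, s1)) s,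
  (fun z => flow (z, x, s2)) s)) by cont.
exact.
Qed.

Lemma flow_continuous : continuous flow.
Proof.
move=> [[z0 x0] t0].
(* The point [(x, t)] is first carried to abscissa [x0], where [flow_lip] compares the two solutions
   up to [z0]; [flow_bound] pays for the moves from [x] to [x0] and from [z0] to [z]. *)
have K p : `|flow (z0, x0, t0) - flow p| <=
   (`|t0 - p.2| + G * `|x0 - p.1.2|) * expR (L * `|z0 - x0|) + G * `|z0 - p.1.1|.
  case: p => [[z x] t] /=.
  rewrite -[in flow (z, x, t)](subrKC (flow (z0, x, t)) (flow (z, x, t))).
  rewrite opprD addrA (le_trans (ler_normB _ _))// lerD//.
    rewrite -(flow_flow x x0 z0 t) (le_trans (flow_lip _ _ _ _))// ler_wpM2r ?expR_ge0//.
    rewrite -(subrKC t (flow _)) opprD addrA (le_trans (ler_normB _ _))// lerD2l.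
    exact: flow_bound.
  by rewrite -(flow_flow x z0 z t) (le_trans (flow_bound _ _ _))// distrC.
pose F (p : R * R * R) : R := (`|t0 - p.2| + G * `|x0 - p.1.2|) * expR (L * `|z0 - x0|) + G * `|z0 - p.1.1|.
have cF : continuous F.
  have : continuous (fun p : R * R * R =>
    (`|t0 - p.2| + G * `|x0 - p.1.2|) * expR (L * `|z0 - x0|) + G * `|z0 - p.1.1|) by cont.
  exact.
apply/cvgrPdist_le => e e0.
have /cvgrPdist_le /(_ _ e0) := cF (z0, x0, t0).
have -> : F (z0, x0, t0) = 0.
  by rewrite /F /= !subrr !normr0 !mulr0 !addr0 mul0r.
apply: filterS => p; rewrite sub0r normrN; apply: le_trans.
exact: le_trans (K p) (ler_norm _).
Qed.

Lemma flowq_continuous : continuous flowq.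
Proof.
have c1 := flow_continuous; have c2 := gdiff_continuous cdg.
have : continuous (fun p : R * (R * R * R) =>
  gdiff dg (p.1, flow (p.1, p.2.1.1, p.2.1.2), flow (p.1, p.2.1.1, p.2.2))) by cont.
exact.
Qed.

End flow.

(** * A Fredholm alternative for operators with a finite rank approximable square *)

Lemma linear_pack {R : pzRingType} {V W : lmodType R} (f : V -> W) : linear f ->
  {g : {linear V -> W} | forall x, g x = f x}.
Proof.
move=> lf; pose F := GRing.isLinear.Build R V W *:%R f lf.
pose g : {linear V -> W} := HB.pack f F.
by exists g.
Qed.

Section bounded_operators.
Context {R : realType}.

Lemma bounded_opP {V W : normedModType R} (L : V -> W) : bounded_op L ->
  exists M, 0 < M /\ forall v, `|L v| <= M * `|v|.
Proof.
move=> [M LM]; exists (`|M| + 1); split; first by rewrite ltr_wpDl.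
move=> v; apply: le_trans (LM v) _; rewrite ler_wpM2r//.
by rewrite (le_trans (ler_norm M))// lerDl.
Qed.

Lemma bounded_op_comp {V W Z : normedModType R} (f : W -> Z) (g : V -> W) :
  bounded_op f -> bounded_op g -> bounded_op (f \o g).
Proof.
move=> /bounded_opP[M [M0 fM]] [N gN]; exists (M * N) => v /=.
by apply: le_trans (fM _) _; rewrite -mulrA ler_wpM2l// ltW.
Qed.

Lemma bounded_op_add {V W : normedModType R} (f g : V -> W) :
  bounded_op f -> bounded_op g -> bounded_op (fun x => f x + g x).
Proof.
move=> [M fM] [N gN]; exists (M + N) => v.
by rewrite mulrDl (le_trans (ler_normD _ _))// lerD.
Qed.

Lemma bounded_op_scale {V W : normedModType R} (k : R) (f : V -> W) :
  bounded_op f -> bounded_op (fun x => k *: f x).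
Proof.
by move=> [M fM]; exists (`|k| * M) => v; rewrite normrZ -mulrA ler_wpM2l.
Qed.

Lemma bounded_op_opp {V W : normedModType R} (f : V -> W) :
  bounded_op f -> bounded_op (fun x => - f x).
Proof. by move=> [M fM]; exists M => v; rewrite normrN. Qed.

Lemma bounded_op_id {V : normedModType R} : bounded_op (fun x : V => x).
Proof. by exists 1 => v; rewrite mul1r. Qed.

Lemma eq_bounded_op {V W : normedModType R} (f g : V -> W) :
  (forall x, f x = g x) -> bounded_op f -> bounded_op g.
Proof. by move=> fg [M fM]; exists M => v; rewrite -fg. Qed.

End bounded_operators.

(** The inverse is built pointwise, as the fixed point of [x = Q x + y]; injectivity of [1 - Q] then
    gives its linearity. *)
Lemma neumann {R : realType} {X : normedModType R} (Q : {linear X -> X})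
    (q : R) : cauchy_complete X -> 0 <= q -> q < 1 -> (forall x, `|Q x| <= q * `|x|) ->
  exists U : {linear X -> X}, [/\ forall y, U y - Q (U y) = y,
    forall x, U (x - Q x) = x & bounded_op U].
Proof.
move=> X_complete q0 q1 Qq.
have ex y : exists x, x = Q x + y.
  apply: (contraction_fixpoint X_complete q0 q1) => x z.
  by rewrite opprD addrACA subrr addr0 -linearB.
have [U UE] := choice ex.
have inj x y : x - Q x = y - Q y -> x = y.
  move=> h; have E : x - y = Q (x - y).
    rewrite linearB; apply/eqP; rewrite subr_eq; apply/eqP.
    by rewrite -[LHS](subrK (Q x)) h -addrA [RHS]addrC [- Q y + _]addrC.
  apply/eqP; rewrite -subr_eq0 -normr_le0.
  have := Qq (x - y); rewrite -E => hq.
  by rewrite -(pmulr_rle0 _ (_ : 0 < 1 - q)) ?subr_gt0// mulrBl mul1r subr_le0.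
have UQ y : U y - Q (U y) = y by rewrite {1}UE addrC addKr.
have lU : linear U.
  move=> a x y; apply: inj; rewrite UQ linearP -[in LHS](UQ x) -[in LHS](UQ y).
  by rewrite scalerBr opprD addrACA.
have [U' U'E] := linear_pack lU.
exists U'; split; first by move=> y; rewrite !U'E.
  by move=> x; rewrite U'E; apply: inj; rewrite UQ.
exists (1 - q)^-1 => y; rewrite U'E ler_pdivlMl ?subr_gt0//.
rewrite mulrBl mul1r lerBlDr -{1}[U y](subrK (Q (U y))) UQ.
by rewrite (le_trans (ler_normD _ _))// lerD2l.
Qed.

(** * Transport of dimension and codimension *)

Section dimension_transport.
Context {R : realType}.

Lemma has_dim_iso {V W : lmodType R} (K : set V) (K' : set W) (d : nat)
    (phi : {linear V -> W}) (psi : {linear W -> V}) :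
  has_dim K d -> (forall x, K x -> K' (phi x)) -> (forall y, K' y -> K (psi y)) ->
  (forall x, K x -> psi (phi x) = x) -> (forall y, K' y -> phi (psi y) = y) ->
  has_dim K' d.
Proof.
move=> [e [efree KE]] KK' K'K phiK psiK.
have phi_sum (c : 'I_d -> R) : phi (\sum_i c i *: e i) = \sum_i c i *: phi (e i).
  by rewrite linear_sum; apply: eq_bigr => i _; rewrite linearZ.
exists (phi \o e); split=> [c /= |].
  rewrite -phi_sum => /(congr1 psi); rewrite linear0 phiK; first exact: efree.
  by rewrite KE; exists c.
apply/seteqP; split=> [y K'y|y [c _ <-]].
  have := K'K _ K'y; rewrite KE => -[c _ cE]; exists c => //=.
  by rewrite -phi_sum cE psiK.
by rewrite /= -phi_sum; apply: KK'; rewrite KE; exists c.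
Qed.

(** [phi] induces an injection of the quotient by the preimage of [S] into [V / S], and this is onto
    as soon as [phi] is onto modulo [S]. *)
Lemma has_codim_preimage {V W : lmodType R} (S : set V) (d : nat)
    (phi : {linear W -> V}) :
  (forall a x y, S x -> S y -> S (a *: x + y)) ->
  (forall v, exists w, S (v - phi w)) -> has_codim S d ->
  has_codim [set w | S (phi w)] d.
Proof.
move=> Slin onto [e [efree espan]].
have S0 : S 0.
  have [w Sw] := onto 0; have := Slin (-1) _ _ Sw Sw.
  by rewrite scaleN1r addNr.
have SD x y : S x -> S y -> S (x + y).
  by move=> Sx Sy; rewrite -[x]scale1r; exact: Slin.
have SZ a x : S x -> S (a *: x) by move=> Sx; rewrite -[_ *: _]addr0; exact: Slin.
have Ssum (c : 'I_d -> R) (x : 'I_d -> V) : (forall i, S (x i)) -> S (\sum_i c i *: x i).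
  by move=> Sx; elim/big_ind: _ => // i _; exact: SZ.
have [w wE] := choice (fun i => onto (e i)).
have diff (c : 'I_d -> R) : S (\sum_i c i *: e i - phi (\sum_i c i *: w i)).
  rewrite linear_sum -sumrB (eq_bigr (fun i => c i *: (e i - phi (w i)))).
    exact: Ssum.
  by move=> i _; rewrite linearZ scalerBr.
exists w; split=> [c /= Sc|u].
  by apply: efree; have := SD _ _ Sc (diff c); rewrite addrC subrK.
have [c Sc] := espan (phi u); exists c => /=.
by have := SD _ _ Sc (diff c); rewrite addrA subrK linearB.
Qed.

Lemma has_dim_kermx {N : nat} (A : 'M[R]_N) :
  has_dim [set c : 'rV[R]_N | c *m A = 0] (\rank (kermx A)).
Proof.
exists (fun i => row i (row_base (kermx A))); split.
  move=> c E i.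
  have {}E : (\row_j c j) *m row_base (kermx A) = 0 *m row_base (kermx A).
    rewrite mul0mx -[RHS]E mulmx_sum_row; apply: eq_bigr => j _.
    by rewrite mxE.
  have /rowP /(_ i) := row_free_inj (row_base_free _) E.
  by rewrite !mxE.
apply/seteqP; split=> [c /= cA|_ [c _ <-] /=].
  have : (c <= row_base (kermx A))%MS by rewrite eq_row_base; apply/sub_kermxP.
  move=> /submxP[D ->]; exists (fun i => D 0 i) => //.
  by rewrite mulmx_sum_row.
apply/sub_kermxP; apply: summx_sub => i _; apply: scalemx_sub.
by rewrite -(eq_row_base (kermx A)) row_sub.
Qed.

(** A basis of the complement [A^C] represents the quotient. Since [A] is square, its row space has
    a complement of the same rank as its kernel; the index 0 comes from here. *)
Lemma has_codim_submx {N : nat} (A : 'M[R]_N) :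
  has_codim [set c : 'rV[R]_N | (c <= A)%MS] (\rank (kermx A)).
Proof.
rewrite mxrank_ker -mxrank_compl.
exists (fun i => row i (row_base (A^C)%MS)); split.
  move=> c /= cA i.
  set s : 'rV[R]_N := \sum_i _ in cA *.
  have sE : s = (\row_j c j) *m row_base (A^C)%MS.
    by rewrite mulmx_sum_row; apply: eq_bigr => j _; rewrite mxE.
  have sC : (s <= A^C)%MS by rewrite sE -(eq_row_base (A^C)%MS) submxMl.
  have : (s <= A :&: A^C)%MS by rewrite sub_capmx cA sC.
  rewrite capmx_compl submx0 sE => /eqP E.
  have {}E : (\row_j c j) *m row_base (A^C)%MS = 0 *m row_base (A^C)%MS by rewrite mul0mx.
  by have /rowP /(_ i) := row_free_inj (row_base_free _) E; rewrite !mxE.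
move=> v; have : (v <= A + A^C)%MS by rewrite submx_full// addsmx_compl_full.
move=> /sub_addsmxP[[u1 u2] /= vE].
have : (u2 *m (A^C)%MS <= row_base (A^C)%MS)%MS by rewrite eq_row_base submxMl.
move=> /submxP[D DE]; exists (fun i => D 0 i) => /=.
by rewrite -mulmx_sum_row -DE vE addrK submxMl.
Qed.

End dimension_transport.

(** The approximants come factored through row vectors, which reduces kernel and cokernel to those
    of a square matrix. *)
Definition finite_rank_approx {R : realType} {X Y : normedModType R}
  (S : X -> Y) := forall eps : R, 0 < eps ->
  exists N (Lam : {linear X -> 'rV[R]_N}) (E : {linear 'rV[R]_N -> Y}),
    bounded_op Lam /\ forall f, `|S f - E (Lam f)| <= eps * `|f|.

(** * The Fredholm alternative *)

Section fredholm.
Context {R : realType} {X : normedModType R}.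
Hypothesis X_complete : cauchy_complete X.

Variable T : {linear X -> X}.
Hypothesis bT : bounded_op T.

(* (1 + lam / k) ^ i = 1 + (i / k) lam + lam ^ 2 r (lam) at lam = T, where
   1 + T / k is invertible once k exceeds the norm of T. *)
Lemma power_expansion (k : R) (k0 : 0 < k) (i : nat) :
  (forall x, `|T x| <= k / 2 * `|x|) ->
  exists J J' r : {linear X -> X}, [/\ bounded_op J, bounded_op r,
    cancel J J', cancel J' J &
    forall f, J f = f + (i%:R / k) *: T f + T (T (r f))].
Proof.
move=> Tk.
(* [Q] is [- T / k], of norm at most 1/2, so that [neumann] inverts [1 - Q = 1 + T / k]. *)
have kT : linear (fun x => - k^-1 *: T x).
  by move=> a x y; rewrite linearP scalerDr !scalerA mulrC.
have [Q QE] := linear_pack kT.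
have Qh x : `|Q x| <= 2^-1 * `|x|.
  have nk : `|- k^-1| = k^-1 by rewrite normrN ger0_norm // invr_ge0 ltW.
  rewrite QE normrZ nk ler_pdivrMl// mulrA.
  exact: Tk.
have h0 : 0 <= (2^-1 : R) by rewrite invr_ge0.
have h1 : (2^-1 : R) < 1 by rewrite invf_lt1// ltr1n.
have [U [QU UQ _]] := neumann X_complete h0 h1 Qh.
elim: i => [|i [J [J' [r [bJ br JJ' J'J JE]]]]].
  have [z zE] : {z : {linear X -> X} | forall x, z x = 0}.
    by apply: linear_pack => a x y; rewrite scaler0 addr0.
  have [I IE] : {z : {linear X -> X} | forall x, z x = x}.
    by apply: linear_pack.
  exists I, I, z; split.
  - exact: eq_bounded_op (fun x => esym (IE x)) bounded_op_id.
  - by exists 0 => v; rewrite zE normr0 mul0r.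
  - by move=> x; rewrite !IE.
  - by move=> x; rewrite !IE.
  - by move=> x; rewrite IE zE !linear0 mul0r scale0r !addr0.
have [K KE] : {z : {linear X -> X} | forall x, z x = J x - Q (J x)}.
  by apply: linear_pack => a x y; rewrite (linearP J) (linearP Q) scalerBr opprD addrACA.
have [K' K'E] : {z : {linear X -> X} | forall x, z x = J' (U x)}.
  by apply: linear_pack => a x y; rewrite !linearP.
(* The new remainder is [r + i / k^2 + T r / k], from the product of [1 + T / k] with
   [1 + (i / k) T + T^2 r]. *)
have [s sE] : {z : {linear X -> X} | forall x,
    z x = (r x + (i%:R / k / k) *: x) + k^-1 *: T (r x)}.
  apply: linear_pack => a x y; rewrite (linearP r) (linearP T) !scalerDr !scalerA.
  rewrite (mulrC a (i%:R / k / k)) (mulrC a k^-1).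
  by rewrite (addrACA (a *: r x)) (addrACA (_ + _) (_ *: _)).
exists K, K', s; split.
- apply: eq_bounded_op (fun x => esym (KE x)) _; apply: bounded_op_add => //.
  apply: bounded_op_opp; apply: (@bounded_op_comp _ _ _ _ Q J _ bJ).
  by exists 2^-1.
- apply: eq_bounded_op (fun x => esym (sE x)) _; apply: bounded_op_add.
    by apply: bounded_op_add => //; apply: bounded_op_scale; exact: bounded_op_id.
  by apply: bounded_op_scale; exact: (bounded_op_comp bT br).
- by move=> x; rewrite K'E KE UQ.
- by move=> x; rewrite KE K'E J'J QU.
- move=> x; rewrite KE QE scaleNr opprK sE.
  have -> : T (J x) = T x + (i%:R / k) *: T (T x) + T (T (T (r x))).
    by rewrite JE !linearD linearZ.
  have -> : T (T ((r x + (i%:R / k / k) *: x) + k^-1 *: T (r x))) =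
      T (T (r x)) + (i%:R / k / k) *: T (T x) + k^-1 *: T (T (T (r x))).
    by rewrite !linearD !linearZ.
  rewrite JE (mulrSr 1 i) mulrDl scalerDl mul1r !scalerDr scalerA (mulrC k^-1).
  by rewrite -!addrA (addrCA (T (T (r x))) (k^-1 *: T x)).
Qed.

Lemma bounded_linear_continuous {V W : normedModType R} (f : {linear V -> W}) :
  bounded_op f -> continuous f.
Proof.
move=> /bounded_opP[M [M0 fM]] x; apply/cvgrPdist_le => e e0.
have e1 : 0 < e / M by rewrite divr_gt0.
have /cvgrPdist_le /(_ _ e1) := @cont_id V x.
apply: filterS => y xy; rewrite -linearB (le_trans (fM _))//.
by rewrite -ler_pdivlMl// mulrC.
Qed.

(** Membership in the row space of [A] means that finitely many continuous functions vanish, the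
    coordinates of [f h *m cokermx A]. *)
Lemma closed_linear_submx {V : normedModType R} (N : nat)
    (f : {linear V -> 'rV[R]_N}) (A : 'M[R]_N) :
  bounded_op f -> closed [set h | (f h <= A)%MS].
Proof.
move=> bf; have cf := bounded_linear_continuous bf.
have -> : [set h | (f h <= A)%MS] =
    \bigcap_(j in [set: 'I_N]) [set h | (f h *m cokermx A) 0 j = 0].
  apply/seteqP; split=> h /=; rewrite submxE.
    by move=> /eqP h0 j _ /=; rewrite h0 mxE.
  by move=> h0; apply/eqP/rowP => j; rewrite [RHS]mxE; exact: (h0 j I).
apply: closed_bigI => j _.
have -> : [set h | (f h *m cokermx A) 0 j = 0] =
    (fun h => (f h *m cokermx A) 0 j) @^-1` [set 0] by [].
apply: closed_comp; last exact: closed_eq.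
move=> h _; have -> : (fun h => (f h *m cokermx A) 0 j) =
    (fun h => \sum_(i <- index_enum 'I_N) f h 0 i * cokermx A i j).
  by apply/funext => u; rewrite mxE.
apply: cvg_big => [|i _]; first exact: add_continuous.
apply: cvgM; last exact: cvg_cst.
exact: (cont_comp (@coord_continuous R 1 N 0 i) cf).
Qed.

Lemma fredholm_alternative : finite_rank_approx (T \o T) ->
  exists d, [/\ has_dim [set f | T f = f] d,
    closed [set h | exists f, f - T f = h] &
    has_codim [set h | exists f, f - T f = h] d].
Proof.
move=> approx; have [M [M0 TM]] := bounded_opP bT.
(* [n] serves both as divisor and as exponent: [n >= 2 * M] makes [1 + T / n] invertible, and its
   n-th power has linear term exactly [T], which cancels that of [1 - T]. *)
pose n := (Num.bound (2 * M)).+1; have n0 : 0 < n%:R :> R by rewrite ltr0n.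
have Tn x : `|T x| <= n%:R / 2 * `|x|.
  apply: le_trans (TM x) _; rewrite ler_wpM2r// ler_pdivlMr// mulrC.
  have M20 : 0 <= 2 * M by rewrite mulr_ge0// ltW.
  by apply: le_trans (ltW (archi_boundP M20)) _; rewrite ler_nat leqnSn.
have [J [J' [r [bJ br JJ' J'J JE]]]] := power_expansion n0 n Tn.
have {}JE f : J f = f + T f + T (T (r f)).
  by rewrite JE divff ?gt_eqF// scale1r.
(* [J (1 - T) = 1 - T^2 + T^2 r (1 - T) = 1 - T^2 r']. *)
have [r' r'E] : {z : {linear X -> X} | forall f, z f = f - r (f - T f)}.
  apply: linear_pack => a x y; rewrite (linearP T) opprD addrACA -scalerBr.
  by rewrite (linearP r) opprD addrACA -scalerBr.
have br' : bounded_op r'.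
  apply: eq_bounded_op (fun x => esym (r'E x)) _.
  apply: bounded_op_add; first exact: bounded_op_id.
  apply: bounded_op_opp; apply: (@bounded_op_comp _ _ _ _ r (fun f => f - T f) br).
  by apply: bounded_op_add; [exact: bounded_op_id|exact: bounded_op_opp].
have J_sub f : J (f - T f) = f - T (T (r' f)).
  have -> : T (T (r' f)) = T (T f) - T (T (r (f - T f))) by rewrite r'E !(linearB T).
  rewrite JE (linearB T) opprB [in LHS]addrA subrK [in RHS]addrA.
  by rewrite [in LHS]addrAC.
have [M' [M'0 r'M]] := bounded_opP br'.
(* With this accuracy [Q = T^2 r' - E Lam r'] has norm at most 1/2. *)
have eps0 : 0 < (2 * M')^-1 by rewrite invr_gt0 mulr_gt0.
have [N [Lam [E [bLam LamE]]]] := approx _ eps0.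
have [Q QE] : {z : {linear X -> X} | forall f, z f = T (T (r' f)) - E (Lam (r' f))}.
  apply: linear_pack => a x y.
  by rewrite (linearP r') (linearP Lam) !(linearP T) (linearP E) opprD addrACA -scalerBr.
have Qh f : `|Q f| <= 2^-1 * `|f|.
  rewrite QE (le_trans (LamE _))// ler_pdivrMl ?mulr_gt0// mulrA.
  by rewrite (mulrAC 2) divff ?pnatr_eq0// mul1r r'M.
have h0 : 0 <= (2^-1 : R) by rewrite invr_ge0.
have h1 : (2^-1 : R) < 1 by rewrite invf_lt1// ltr1n.
have [U [QU UQ bU]] := neumann X_complete h0 h1 Qh.
have [L' L'E] : {z : {linear X -> 'rV[R]_N} | forall f, z f = Lam (r' f)}.
  by apply: linear_pack => a x y; rewrite (linearP r') (linearP Lam).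
have bL' : bounded_op L'.
  by apply: eq_bounded_op (fun x => esym (L'E x)) _; exact: bounded_op_comp bLam br'.
have [E' E'E] : {z : {linear 'rV[R]_N -> X} | forall c, z c = U (E c)}.
  by apply: linear_pack => a x y; rewrite (linearP E) (linearP U).
(* [J (1 - T) = (1 - Q) - E Lam r'] and [U] inverts [1 - Q], so the invertible [V = U J] turns
   [1 - T] into [1 - E' L']. *)
pose V h := U (J h); pose V' y := J' (y - Q y).
have VV' y : V (V' y) = y by rewrite /V /V' J'J UQ.
have V_inj x y : V x = V y -> x = y.
  move=> Vxy; apply: (can_inj JJ'); rewrite -(QU (J x)) -(QU (J y)).
  by rewrite -/(V x) -/(V y) Vxy.
have V_sub f : V (f - T f) = f - E' (L' f).
  rewrite /V J_sub E'E L'E.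
  transitivity (U (f - Q f) - U (E (Lam (r' f)))); last by rewrite UQ.
  rewrite -linearB; congr (U _); by rewrite QE opprB [RHS]addrAC subrKA.
have V0 : V 0 = 0 by rewrite /V !linear0.
have [G GE] : {z : {linear 'rV[R]_N -> 'rV[R]_N} | forall c, z c = L' (E' c)}.
  by apply: linear_pack => a x y; rewrite (linearP E') (linearP L').
pose A := 1%:M - lin1_mx G.
have AE c : c *m A = c - L' (E' c).
  by rewrite mulmxBr mulmx1 mul_rV_lin1 GE.
have [Psi PsiE] : {z : {linear X -> 'rV[R]_N} | forall h, z h = L' (V h)}.
  by apply: linear_pack => a x y; rewrite /V (linearP J) (linearP U) (linearP L').
have bPsi : bounded_op Psi.
  apply: eq_bounded_op (fun x => esym (PsiE x)) _.
  exact: bounded_op_comp bL' (bounded_op_comp bU bJ).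
have imE : [set h | exists f, f - T f = h] = [set h | (Psi h <= A)%MS].
  apply/seteqP; split=> [h [f <-] /=|h /= /submxP[c]].
    apply/submxP; exists (L' f).
    by rewrite PsiE V_sub AE -linearB.
  (* For this preimage [f] one finds [L' f = c], hence [f - E' (L' f) = V h]. *)
  rewrite PsiE AE => cE; exists (V h + E' c); apply: V_inj; rewrite V_sub.
  by rewrite linearD cE subrK addrK.
exists (\rank (kermx A)); split.
- apply: (has_dim_iso (phi := E') (psi := L') (has_dim_kermx A)) => /=.
  + move=> c; rewrite AE => /eqP; rewrite subr_eq0 => /eqP cE.
    suff : E' c - T (E' c) = 0 by move/eqP; rewrite subr_eq0 => /eqP.
    by apply: V_inj; rewrite V_sub V0 -cE subrr.
  + by move=> f fE; rewrite AE -linearB -V_sub fE subrr V0 linear0.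
  + by move=> c; rewrite AE => /eqP; rewrite subr_eq0 => /eqP.
  + move=> f fE; apply/eqP; rewrite eq_sym -subr_eq0 -V_sub fE subrr V0.
    exact: eqxx.
- by rewrite imE; exact: closed_linear_submx.
- rewrite imE.
  apply: (has_codim_preimage (phi := Psi) (S := [set c | (c <= A)%MS])).
  + by move=> a x y /= xA yA; rewrite addmx_sub// scalemx_sub.
  (* [Psi] sends this vector to [L' (E' c) = c - c *m A], which agrees with [c] modulo the row space
     of [A]. *)
  + move=> c /=; exists (V' (E' c)); rewrite PsiE VV' -AE; exact: submxMl.
  + exact: has_codim_submx.
Qed.

End fredholm.

(** * Inverting 1 - C when a power of C is a contraction *)

Section power_contraction.
Context {R : realType} {X : normedModType R}.
Hypothesis X_complete : cauchy_complete X.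
Variable C : {linear X -> X}.
Hypothesis bC : bounded_op C.

Lemma opnorm_lt1 (L : {linear X -> X}) : (opnorm L < 1%:E)%E ->
  exists q : R, [/\ 0 <= q, q < 1 & forall x, `|L x| <= q * `|x|].
Proof.
move=> L1.
have ub x : `|x| <= 1 -> (`|L x|%:E <= opnorm L)%E.
  by move=> x1; apply: ereal_sup_ubound; exists x.
have op0 : (0%:E <= opnorm L)%E.
  by have := ub 0; rewrite normr0 linear0 normr0; apply.
have fin : (opnorm L \is a fin_num)%E.
  by rewrite ge0_fin_numE// (lt_trans L1)// ltry.
exists (fine (opnorm L)); split.
- exact: fine_ge0.
- by rewrite -lte_fin fineK.
- move=> x; have [->|x0] := eqVneq x 0; first by rewrite linear0 normr0 mulr0.
  have xn : 0 < `|x| by rewrite normr_gt0.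
  have := ub (`|x|^-1 *: x).
  rewrite normrZ ger0_norm ?invr_ge0// mulVf ?gt_eqF// => /(_ (lexx _)).
  rewrite linearZ normrZ ger0_norm ?invr_ge0// -(fineK fin) lee_fin.
  by rewrite ler_pdivrMl// mulrC.
Qed.

(** [S] is the sum of the powers of [C] below [l], and [S - C S] telescopes. *)
Lemma geometric_sum (l : nat) : exists S Cl : {linear X -> X},
  [/\ bounded_op S, bounded_op Cl, forall x, Cl x = iter l C x &
   forall x, S x - C (S x) = x - Cl x].
Proof.
elim: l => [|l [S [Cl [bS bCl ClE SE]]]].
  have [z zE] : {z : {linear X -> X} | forall x, z x = 0}.
    by apply: linear_pack => a x y; rewrite scaler0 addr0.
  have [I IE] : {z : {linear X -> X} | forall x, z x = x}.
    by apply: linear_pack.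
  exists z, I; split=> //.
  - by exists 0 => v; rewrite zE normr0 mul0r.
  - exact: eq_bounded_op (fun x => esym (IE x)) bounded_op_id.
  - by move=> x; rewrite zE linear0 IE !subrr.
have [S' S'E] : {z : {linear X -> X} | forall x, z x = S x + Cl x}.
  by apply: linear_pack => a x y; rewrite !linearP scalerDr addrACA.
have [D DE] : {z : {linear X -> X} | forall x, z x = C (Cl x)}.
  by apply: linear_pack => a x y; rewrite !linearP.
exists S', D; split.
- by apply: eq_bounded_op (fun x => esym (S'E x)) _; exact: bounded_op_add.
- by apply: eq_bounded_op (fun x => esym (DE x)) _; exact: bounded_op_comp.
- by move=> x; rewrite DE ClE.
- by move=> x; rewrite S'E DE linearD opprD addrACA SE subrKA.
Qed.

(** [S] composed with the inverse of [1 - C^l] is a right inverse of [1 - C]. Uniqueness holds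
    because a fixed point of [C] is one of [C^l]. *)
Lemma power_contraction_inverse (l : nat) : (opnorm (iter l C) < 1%:E)%E ->
  exists U : {linear X -> X}, [/\ bounded_op U, forall y, U y - C (U y) = y &
    forall x y, x - C x = y -> x = U y].
Proof.
have [S [Cl [bS bCl ClE SE]]] := geometric_sum l.
have -> : iter l C = Cl by apply/funext => x; rewrite ClE.
move=> /opnorm_lt1[q [q0 q1 Clq]].
have [U0 [UQ QU bU0]] := neumann X_complete q0 q1 Clq.
have [U UE] : {z : {linear X -> X} | forall x, z x = S (U0 x)}.
  by apply: linear_pack => a x y; rewrite !linearP.
have CU y : U y - C (U y) = y by rewrite UE SE UQ.
exists U; split=> //.
  by apply: eq_bounded_op (fun x => esym (UE x)) _; exact: bounded_op_comp.
move=> x y xy; apply/eqP; rewrite -subr_eq0; apply/eqP.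
set d := x - U y.
have Cd : C d = d.
  have E : d - C d = (x - C x) - (U y - C (U y)).
    by rewrite /d linearB !opprD !opprK addrACA.
  by apply/eqP; rewrite eq_sym -subr_eq0 E xy CU subrr.
have Cld : Cl d = d by rewrite ClE; elim: l {ClE SE} => //= k ->.
by rewrite -(QU d) Cld subrr linear0.
Qed.

End power_contraction.

Lemma finite_rank_approx_comp {R : realType} {X Y Z : normedModType R}
    (L : {linear Y -> Z}) (S : X -> Y) (S' : X -> Z) :
  (forall x, S' x = L (S x)) ->
  bounded_op L -> finite_rank_approx S -> finite_rank_approx S'.
Proof.
move=> S'E /bounded_opP[M [M0 LM]] approx e e0.
have e1 : 0 < e / M by rewrite divr_gt0.
have [N [Lam [E [bLam H]]]] := approx _ e1.
have [LE LEE] : {z : {linear 'rV[R]_N -> Z} | forall c, z c = L (E c)}.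
  by apply: linear_pack => a x y; rewrite !linearP.
exists N, Lam, LE; split=> // f.
rewrite S'E LEE -linearB (le_trans (LM _))// -ler_pdivlMl// mulrA (mulrC _ e).
exact: H.
Qed.

(* With g = B u + f the equation u = C u + F (B u + f) reads g - T g = f, where
   T = B (1 - C)^-1 F, and T^2 = B (1 - C)^-1 (F B (1 - C)^-1 F). *)
Theorem mild_fredholm {R : realType} {X : normedModType R}
    (C F B : {linear X -> X}) (l : nat) :
  cauchy_complete X -> bounded_op C -> bounded_op F -> bounded_op B ->
  (opnorm (iter l C) < 1%:E)%E ->
  (forall V : {linear X -> X}, bounded_op V -> (forall f, V f = C (V f) + F f) ->
    exists2 W : {linear X -> X}, (forall f, W f = F (B (V f))) & finite_rank_approx W) ->
  exists d, [/\ has_dim [set u | u = C u + F (B u)] d,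
    closed [set f | exists u, u = C u + F (B u + f)] &
    has_codim [set f | exists u, u = C u + F (B u + f)] d].
Proof.
move=> X_complete bC bF bB Cl approx.
have [U [bU UC CU]] := power_contraction_inverse X_complete bC Cl.
have [V VE] : {z : {linear X -> X} | forall f, z f = U (F f)}.
  by apply: linear_pack => a x y; rewrite !linearP.
have bV : bounded_op V.
  by apply: eq_bounded_op (fun x => esym (VE x)) _; exact: bounded_op_comp.
have VC f : V f - C (V f) = F f by rewrite VE UC.
have CV u f : u - C u = F f -> u = V f by move=> /CU ->; rewrite VE.
have [T TE] : {z : {linear X -> X} | forall f, z f = B (V f)}.
  by apply: linear_pack => a x y; rewrite !linearP.
have bT : bounded_op T.
  by apply: eq_bounded_op (fun x => esym (TE x)) _; exact: bounded_op_comp.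
have VCF f : V f = C (V f) + F f by rewrite -(VC f) addrC subrK.
have [W WE aW] := approx V bV VCF.
have [BU BUE] : {z : {linear X -> X} | forall f, z f = B (U f)}.
  by apply: linear_pack => a x y; rewrite !linearP.
have bBU : bounded_op BU.
  by apply: eq_bounded_op (fun x => esym (BUE x)) _; exact: bounded_op_comp.
have aT : finite_rank_approx (T \o T).
  apply: (finite_rank_approx_comp (L := BU) _ bBU aW) => f.
  by rewrite BUE WE /= !TE VE.
have [d [dK cS cdS]] := fredholm_alternative X_complete bT aT.
have eqP1 u f : u = C u + F f <-> u = V f.
  split=> [uE|->]; last by rewrite -(VC f) addrC subrK.
  by apply: CV; rewrite {1}uE addrC addKr.
have solE : [set f | exists u, u = C u + F (B u + f)] = [set h | exists f, f - T f = h].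
  apply/seteqP; split=> f [u] uE.
    exists (B u + f); rewrite TE; have /eqP1 <- := uE.
    by rewrite addrC addKr.
  by exists (V u); apply/eqP1; rewrite -uE TE addrC subrK.
exists d; split; rewrite ?solE//.
(* For the homogeneous problem [g = B u] and [u = V g] are inverse to each other. *)
apply: (has_dim_iso (phi := V) (psi := B) dK) => /=.
- by move=> g gE; apply/eqP1; rewrite -{1}gE TE.
- by move=> u /eqP1 uE; rewrite TE -uE.
- by move=> g gE; rewrite -TE.
- by move=> u /eqP1 <-.
Qed.

(** * The strip *)

Section row_norm.
Context {R : realType} {m n : nat}.

Lemma mx_ler_coord (v : 'M[R]_(m, n)) i j : `|v i j| <= `|v|.
Proof.
rewrite -[leRHS]/(mx_norm v) mx_normrE.
by apply: (@le_bigmax _ _ _ 0 (fun ij => `|v ij.1 ij.2|) (i, j)).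
Qed.

Lemma mx_norm_le (v : 'M[R]_(m, n)) M : 0 <= M -> (forall i j, `|v i j| <= M) ->
  `|v| <= M.
Proof.
move=> M0 vM; rewrite -[leLHS]/(mx_norm v) mx_normrE.
by apply: bigmax_le => // -[i j] _; exact: vM.
Qed.

Lemma cont_coord {T : topologicalType} (f : T -> 'M[R]_(m, n)) i j : continuous f ->
  continuous (fun x => f x i j).
Proof. by move=> cf; exact: (cont_comp (@coord_continuous R m n i j) cf). Qed.

Lemma cont_mx {T : topologicalType} (f : T -> 'M[R]_(m, n)) :
  (forall i j, continuous (fun x => f x i j)) -> continuous f.
Proof.
move=> cf x; apply/cvgrPdist_le => e e0.
have : \forall y \near x, forall ij : 'I_m * 'I_n, `|f x ij.1 ij.2 - f y ij.1 ij.2| <= e.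
  apply: (@filter_forall T ('I_m * 'I_n)%type (fun ij y =>
    `|f x ij.1 ij.2 - f y ij.1 ij.2| <= e)) => -[i j] /=.
  by have /cvgrPdist_le := cf i j x; exact.
apply: filterS => y fy; apply: mx_norm_le => [|i j]; first exact: ltW.
by have := fy (i, j); rewrite !mxE.
Qed.

End row_norm.

Section unit_interval.
Context {R : realType}.
Implicit Types x y s : R.

Lemma dist01 x y : 0 <= x <= 1 -> 0 <= y <= 1 -> `|x - y| <= 1.
Proof.
move=> /andP[x0 x1] /andP[y0 y1]; rewrite ler_norml; apply/andP; split; lra.
Qed.

Lemma in01 x y s : 0 <= x <= 1 -> 0 <= y <= 1 ->
  Num.min x y <= s <= Num.max x y -> 0 <= s <= 1.
Proof.
move=> /andP[x0 x1] /andP[y0 y1] /andP[s1 s2]; apply/andP; split.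
  by apply: le_trans s1; rewrite le_min x0 y0.
by apply: le_trans s2 _; rewrite ge_max x1 y1.
Qed.

Lemma segment_near_bound (s1 s2 s t d : R) : s1 <= s <= s2 -> `|s - t| <= d ->
  `|t| < `|s1| + `|s2| + d + 1.
Proof.
move=> /andP[s1s ss2] std.
have s12 : `|s| <= `|s1| + `|s2|.
  have := ler_norm s2; have := ler_norm (- s1); rewrite normrN.
  have := normr_ge0 s1; have := normr_ge0 s2.
  by move=> h1 h2 h3 h4; rewrite ler_norml; apply/andP; split; lra.
rewrite ltr_pwDr// -[t](subrK s) (le_trans (ler_normD _ _))// addrC lerD//.
by rewrite distrC.
Qed.

End unit_interval.

Section strip_topology.
Context {R : realType}.
Implicit Types (x : I01 R) (p q : strip R).

Lemma val01 x : 0 <= val x <= 1.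
Proof. by case: x => s /=; rewrite inE /= in_itv. Qed.

(** The retraction of the line onto [0, 1]; composition with it extends functions continuously from
    the strip to the plane. *)
Definition clamp (s : R) : I01 R := to01 (Num.max 0 (Num.min 1 s)).

Lemma val_to01 (s : R) : 0 <= s <= 1 -> val (to01 s) = s.
Proof. by move=> s01; rewrite /to01 insubdK// inE /= in_itv. Qed.

Lemma val_clamp (s : R) : val (clamp s) = Num.max 0 (Num.min 1 s).
Proof. by apply: val_to01; rewrite le_max lexx/= ge_max ler01 ge_min lexx. Qed.

Lemma val_clamp_id (s : R) : 0 <= s <= 1 -> val (clamp s) = s.
Proof. by move=> /andP[s0 s1]; rewrite val_clamp min_r// max_r. Qed.

Lemma clamp_val x : clamp (val x) = x.
Proof. by apply: val_inj; rewrite val_clamp_id// val01. Qed.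

Lemma val_continuous : continuous (val : I01 R -> R).
Proof. exact: initial_continuous. Qed.

Lemma clamp_continuous : continuous clamp.
Proof.
apply: (@continuous_comp_initial _ _ _ (set_val : I01 R -> R)).
have -> : (set_val : I01 R -> R) \o clamp = (fun s => Num.max 0 (Num.min 1 s)).
  by apply/funext => s; rewrite /= -[LHS]/(val (clamp s)) val_clamp.
by cont.
Qed.

Lemma nbhs_strip p (A : set (strip R)) : nbhs p A -> exists2 d : R, 0 < d &
  forall q, `|val p.1 - val q.1| < d -> `|p.2 - q.2| < d -> A q.
Proof.
move=> /nbhs_ballP[d d0 dA]; exists d => // q h1 h2; apply: dA.
by split => //; rewrite -ball_normE.
Qed.

Lemma ext_continuous {V : topologicalType} (u : strip R -> V) : continuous u ->
  continuous (fun p : R * R => u (clamp p.1, p.2)).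
Proof. by move=> cu; have cc := clamp_continuous; cont. Qed.

Lemma res_continuous {V : topologicalType} (u : R * R -> V) : continuous u ->
  continuous (fun p : strip R => u (val p.1, p.2)).
Proof.
move=> cu; apply: (cont_comp cu); apply: cont_pair; last first.
  exact: (cont_snd (@cont_id (strip R))).
exact: (cont_comp val_continuous (cont_fst (@cont_id (strip R)))).
Qed.

End strip_topology.

(** * Finite rank approximation from equicontinuity and decay *)

Section finite_rank.
Context {R : realType} {X : normedModType R} {n : nat}.
Variable W : {linear X -> BC (strip R) 'rV[R]_n}.
Hypothesis bW : bounded_op W.
Hypothesis W_equicont : forall eps : R, 0 < eps -> forall p0 : strip R,
  \forall p \near p0, forall f, `|W f p0 - W f p| <= eps * `|f|.
Hypothesis W_decay : forall eps : R, 0 < eps -> exists M, forall (p : strip R) f,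
  M <= `|p.2| -> `|W f p| <= eps * `|f|.

(** The equicontinuity is relative to the norm of [f], so the radii do not depend on [f]; decay
    reduces the covering to a compact rectangle. *)
Lemma finite_net (eps : R) (eps0 : 0 < eps) :
  exists (M : R) (k : nat) (p : 'I_k -> strip R) (d : 'I_k -> R),
  [/\ forall (q : strip R) f, M <= `|q.2| -> `|W f q| <= eps * `|f|,
    forall i (q : strip R), `|val (p i).1 - val q.1| < d i -> `|(p i).2 - q.2| < d i ->
      forall f, `|W f (p i) - W f q| <= eps * `|f| &
    forall q : strip R, M < `|q.2| \/
      exists i, `|val (p i).1 - val q.1| < d i /\ `|(p i).2 - q.2| < d i].
Proof.
have [M WM] := W_decay eps0.
have nd (p : R * R) : exists d : R, 0 < d /\ forall q : strip R,
    `|val (clamp p.1) - val q.1| < d -> `|p.2 - q.2| < d ->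
    forall f, `|W f (clamp p.1, p.2) - W f q| <= eps * `|f|.
  have [d d0 dP] := nbhs_strip (W_equicont eps0 (clamp p.1, p.2)).
  by exists d; split.
have [d dP] := choice nd.
pose O (p : R * R) : set (R * R) := ball p.1 (d p) `*` ball p.2 (d p).
pose K : set (R * R) := `[0, 1] `*` `[- M, M].
have cK : compact K by apply: compact_setX; exact: segment_compact.
(* Along the filter of lists containing a given list, near-covering compactness yields a single
   list, that is a finite subcover. Its centres are taken in [K], where [clamp] fixes the first
   coordinate. *)
pose F : set_system (seq (R * R)) :=
  filter_from [set: seq (R * R)] (fun s0 => [set s : seq (R * R) | {subset s0 <= s}]).
have FF : Filter F.
  apply: filter_from_filter; first by exists [::].
  move=> s1 s2 _ _; exists (s1 ++ s2) => // s /= sub; split=> p ps; apply: sub;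
    by rewrite mem_cat ps ?orbT.
have /compact_near_coveringP C := cK.
have Kcov : F [set s : seq (R * R) | K `<=` [set q | exists2 p, p \in s & (K p /\ O p q)]].
  apply: (C _ F (fun (s : seq (R * R)) q => exists2 p, p \in s & (K p /\ O p q)) FF) => q Kq.
  exists (O q, [set s : seq (R * R) | q \in s]) => /=; last first.
    by move=> [q' s] /= [Oq qs]; exists q.
  split; last by exists [:: q] => // s /=; apply; rewrite mem_head.
  exists (ball q.1 (d q), ball q.2 (d q)); last by case.
  by split; apply: nbhsx_ballx; exact: (dP q).1.
have [s _ sP] := Kcov.
have {}Kcov := sP s (fun _ h => h).
exists M, (size s), (fun i => (clamp (nth 0 s i).1, (nth 0 s i).2)), (fun i => d (nth 0 s i)).
split=> [//|i q h1 h2 f|q]; first exact: (dP _).2.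
have [Mq|qM] := ltP M `|q.2|; [by left|right].
have Kq : K (val q.1, q.2).
  split => /=; rewrite in_itv/=; first exact: val01.
  by rewrite -ler_norml.
have [p ps [Kp [Op1 Op2]]] := Kcov _ Kq.
have pi : (index p s < size s)%N by rewrite index_mem.
exists (Ordinal pi) => /=; rewrite nth_index//; split; last first.
  by move: Op2; rewrite -ball_normE.
rewrite val_clamp_id; first by move: Op1; rewrite -ball_normE.
by case: Kp => /=; rewrite in_itv.
Qed.

Lemma equicontinuous_finite_rank : finite_rank_approx W.
Proof.
move=> eps eps0; have [M [k [p [d [Wdec Wnet cover]]]]] := finite_net eps0.
(* Unnormalised partition of unity: [psi i] is supported near [p i], where [W f] is replaced by its
   value at [p i], and [psiI] on [|t| >= M], where it is replaced by 0. *)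
pose psi i (q : strip R) : R := Num.max 0 (d i - `|val (p i).1 - val q.1|) *
  Num.max 0 (d i - `|(p i).2 - q.2|).
pose psiI (q : strip R) : R := Num.max 0 (`|q.2| - M).
have psi0 i q : 0 <= psi i q by rewrite mulr_ge0// le_max lexx.
have psiI0 q : 0 <= psiI q by rewrite le_max lexx.
pose tot q := psiI q + \sum_i psi i q.
have tot0 q : 0 < tot q.
  have [Mq|[i [h1 h2]]] := cover q.
    by rewrite ltr_wpDr ?sumr_ge0// lt_max subr_gt0 Mq orbT.
  rewrite ltr_wpDl// (bigD1 i)//= ltr_wpDr ?sumr_ge0//.
  by rewrite mulr_gt0// lt_max subr_gt0 ?h1 ?h2 orbT.
have c1 : continuous (fun q : strip R => val q.1).
  exact: (cont_comp val_continuous (cont_fst (@cont_id (strip R)))).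
have c2 : continuous (fun q : strip R => q.2).
  exact: (cont_snd (@cont_id (strip R))).
have cpsi i : continuous (psi i).
  have : continuous (fun q => Num.max 0 (d i - `|val (p i).1 - (fun q : strip R => val q.1) q|) *
     Num.max 0 (d i - `|(p i).2 - (fun q : strip R => q.2) q|)) by cont.
  exact.
have cpsiI : continuous psiI.
  have : continuous (fun q => Num.max 0 (`|(fun q : strip R => q.2) q| - M)) by cont.
  exact.
have csum (F : 'I_k -> strip R -> R) : (forall i, continuous (F i)) ->
    continuous (fun q => \sum_i F i q).
  move=> cF q; apply: cvg_big => [|i _]; [exact: add_continuous|exact: cF].
have ctot : continuous (fun q => (tot q)^-1).
  apply: cont_inv => [q|]; first by rewrite gt_eqF.
  by apply: cont_add => //; exact: csum.
pose E0 (c : 'rV[R]_(k * n)) (q : strip R) : 'rV[R]_n :=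
  \row_j ((tot q)^-1 * \sum_i psi i q * vec_mx c i j).
have cE0 c : continuous (E0 c).
  apply: cont_mx => i j; have -> : (fun q => E0 c q i j) =
      fun q => (tot q)^-1 * \sum_i psi i q * vec_mx c i j.
    by apply/funext => q; rewrite mxE.
  apply: cont_mul => //; apply: csum => l; apply: cont_mul => //; exact: cont_cst.
have psi_tot q : \sum_i psi i q <= tot q by rewrite lerDr.
have bE0 c : exists B, forall q, `|E0 c q| <= B.
  exists `|vec_mx c : 'M[R]_(k, n)| => q; apply: mx_norm_le => // i j.
  rewrite mxE normrM ger0_norm ?invr_ge0 ?(ltW (tot0 _))// ler_pdivrMl//.
  apply: le_trans (ler_norm_sum _ _ _) _.
  apply: le_trans (ler_wpM2r (normr_ge0 _) (psi_tot q)).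
  rewrite mulr_suml; apply: ler_sum => l _.
  by rewrite normrM ger0_norm// ler_wpM2l// mx_ler_coord.
have [E EE] : {z : {linear 'rV[R]_(k * n) -> BC (strip R) 'rV[R]_n} |
    forall c, z c = toBC (E0 c)}.
  apply: linear_pack => u x y; apply: bc_ext => q.
  rewrite bc_addE bc_scaleE !toBCE//; apply/rowP => j; rewrite !mxE.
  rewrite mulrCA -mulrDr; congr (_ * _); rewrite mulr_sumr -big_split /=.
  by apply: eq_bigr => l _; rewrite linearP !mxE mulrDr mulrCA.
have [Lam LamE] : {z : {linear X -> 'rV[R]_(k * n)} |
    forall f, z f = mxvec (\matrix_(i, j) W f (p i) 0 j)}.
  apply: linear_pack => u x y; rewrite -linearP; congr mxvec.
  by apply/matrixP => i j; rewrite !mxE linearP bc_addE bc_scaleE !mxE.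
exists (k * n)%N, Lam, E; split.
  have [B [B0 WB]] := bounded_opP bW.
  exists B => f; rewrite LamE; apply: mx_norm_le => [|i j]; first by rewrite mulr_ge0// ltW.
  have [i' j'] := mxvec_indexP j; rewrite ord1 mxvecE mxE.
  apply: le_trans (mx_ler_coord _ _ _) _.
  exact: le_trans (bc_ler_norm _ _) (WB f).
move=> f; apply: bc_norm_le => [|q]; first by rewrite mulr_ge0// ltW.
rewrite bc_subE EE toBCE//; apply: mx_norm_le => [|i j]; first by rewrite mulr_ge0// ltW.
rewrite !mxE ord1 LamE mxvecK.
(* The error is a weighted mean of local errors, each at most [eps * |f|] wherever its weight is
   nonzero. *)
have -> : W f q 0 j - (tot q)^-1 * (\sum_i psi i q * (\matrix_(i, j) W f (p i) 0 j) i j) =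
    (tot q)^-1 * (psiI q * W f q 0 j + \sum_i psi i q * (W f q 0 j - W f (p i) 0 j)).
  apply: (canRL (mulKf _)); first by rewrite gt_eqF.
  rewrite mulrBr mulVKf ?gt_eqF// /tot mulrDl -addrA; congr (_ + _).
  rewrite mulr_suml -sumrB; apply: eq_bigr => l _.
  by rewrite mxE mulrBr.
rewrite normrM ger0_norm ?invr_ge0 ?(ltW (tot0 _))// ler_pdivrMl//.
apply: le_trans (ler_normD _ _) _; rewrite /tot mulrDl; apply: lerD.
  rewrite normrM ger0_norm//; have [Mq|qM] := leP M `|q.2|.
    rewrite ler_wpM2l//; apply: le_trans (mx_ler_coord _ _ _) _; exact: Wdec.
  by rewrite /psiI max_l ?mul0r// subr_le0 ltW.
apply: le_trans (ler_norm_sum _ _ _) _; rewrite mulr_suml; apply: ler_sum => l _.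
rewrite normrM ger0_norm//.
have [h1|h1] := ltP `|val (p l).1 - val q.1| (d l); last first.
  by rewrite /psi max_l ?mul0r// subr_le0.
have [h2|h2] := ltP `|(p l).2 - q.2| (d l); last first.
  by rewrite /psi (@max_l _ _ _ (d l - `|(p l).2 - q.2|)) ?mulr0 ?mul0r// subr_le0.
rewrite ler_wpM2l//; apply: le_trans (Wnet _ _ h1 h2 f).
rewrite distrC; apply: le_trans (mx_ler_coord _ 0 j).
by rewrite !mxE.
Qed.

End finite_rank.

(** * Smoothing by integration across characteristics *)

Section smoothing.
Context {R : realType} {T : topologicalType}.
Variables (w th dth : R * T -> R).
Hypothesis cw : continuous w.
Hypothesis cth : continuous th.
Hypothesis cdth : continuous dth.
Hypothesis thD : forall s q, is_derive s (1 : R) (fun s => th (s, q)) (dth (s, q)).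

(** The second variable labels characteristics, and continuity is all that is asked in it; the first
    is the position along them, where a bounded source makes [z] Lipschitz. *)
Definition transported (N : R) (z : R * R -> R) : Prop :=
  [/\ continuous z, forall s u, 0 <= s <= 1 -> `|z (s, u)| <= N &
   forall s s' u, 0 <= s <= 1 -> 0 <= s' <= 1 -> `|z (s, u) - z (s', u)| <= N * `|s - s'|].

(** In the application [q] determines a j-characteristic, and [th (s, q)] is the label of the
    k-characteristic that it meets at [s]. *)
Definition integrand (z : R * R -> R) (q : T) (s : R) : R :=
  w (s, q) * z (s, th (s, q)) * dth (s, q).

Lemma cont_slice (F : R * T -> R) (q : T) : continuous F -> continuous (fun s => F (s, q)).
Proof. by move=> cF; cont. Qed.

Lemma integrand_continuous z q : continuous z -> continuous (integrand z q).
Proof.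
move=> cz; have c1 := cont_slice (q := q) cw; have c2 := cont_slice (q := q) cth.
have c3 := cont_slice (q := q) cdth.
have : continuous (fun s => w (s, q) * z (s, th (s, q)) * dth (s, q)) by cont.
exact.
Qed.

(* With w and the first argument of z frozen, the integrand is a total
   derivative, so that its integral depends on th at the end points only. *)
Lemma frozen_piece (N M e1 e2 d : R) (z : R * R -> R) (q0 q : T) (y x : R) :
  transported N z -> 0 <= y <= 1 -> 0 <= x <= 1 -> `|x - y| <= d ->
  (forall s s', 0 <= s <= 1 -> 0 <= s' <= 1 -> `|s - s'| <= d -> `|w (s, q0) - w (s', q0)| <= e1) ->
  (forall s, 0 <= s <= 1 -> `|w (s, q0)| <= M) ->
  (forall s, 0 <= s <= 1 -> `|w (s, q) - w (s, q0)| <= e1) ->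
  (forall s, 0 <= s <= 1 -> `|dth (s, q0)| <= M) ->
  (forall s, 0 <= s <= 1 -> `|dth (s, q)| <= M) ->
  (forall s, 0 <= s <= 1 -> `|th (s, q) - th (s, q0)| <= e2) ->
  `|oint y x (integrand z q0) - oint y x (integrand z q)| <=
    N * (2 * (2 * e1 + M * d) * M * `|x - y| + 2 * M * e2).
Proof.
move=> [cz zN zL] y01 x01 xyd wmod wM wq dM dMq thq.
have N0 : 0 <= N := le_trans (normr_ge0 _) (zN _ 0 y01).
have M0 : 0 <= M := le_trans (normr_ge0 _) (wM _ y01).
have e10 : 0 <= e1 := le_trans (normr_ge0 _) (wq _ y01).
have d0 : 0 <= d := le_trans (normr_ge0 _) xyd.
pose zy u := z (y, u).
have czy : continuous zy by have : continuous (fun u => z (y, u)) by cont.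
(* Only this primitive is compared between [q0] and [q]. Its Lipschitz constant [N] replaces a
   modulus of continuity of [z] in its second variable. *)
pose Z u := oint 0 u zy.
have ZD u : is_derive u (1 : R) Z (zy u) := is_derive_oint 0 u czy.
have Zlip u v : `|Z u - Z v| <= N * `|u - v|.
  have -> : Z u - Z v = - oint u v zy.
    by rewrite /Z -(oint_cat 0 u v czy) opprD addrA subrr add0r.
  by rewrite normrN (distrC u); apply: oint_bound => // s _; exact: zN.
pose J q' := w (y, q0) * (Z (th (x, q')) - Z (th (y, q'))).
pose fr q' s := w (y, q0) * (zy (th (s, q')) * dth (s, q')).
have cfr q' : continuous (fr q').
  have c2 := cont_slice (q := q') cth; have c3 := cont_slice (q := q') cdth.
  have : continuous (fun s => w (y, q0) * (zy (th (s, q')) * dth (s, q'))) by cont.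
  exact.
have JE q' : oint y x (fr q') = J q'.
  have D s : is_derive s (1 : R) (fun s => w (y, q0) * (fun s => Z (th (s, q'))) s) (fr q' s).
    have D1 : is_derive s (1 : R) (fun s => Z (th (s, q'))) (zy (th (s, q')) * dth (s, q')).
      exact: (is_derive1_comp (ZD _) (thD s q')).
    apply: derive_val (derive_mul (is_derive_cst _ _ _) D1) _.
    by rewrite mulr0 addr0.
  by rewrite (oint_FTC y x (cfr q') D) -mulrBr.
(* Cost of freezing: [w] changes by [e1] in the parameter and by [e1] in [s], while [z] changes by
   at most [N * d]. *)
have IJ q' : (forall s, 0 <= s <= 1 -> `|w (s, q') - w (s, q0)| <= e1) ->
    (forall s, 0 <= s <= 1 -> `|dth (s, q')| <= M) ->
    `|oint y x (integrand z q') - J q'| <= N * (2 * e1 + M * d) * M * `|x - y|.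
  move=> wq' dq'; have ci := integrand_continuous (q := q') cz.
  rewrite -JE -ointB//.
  have c : continuous (fun s => integrand z q' s - fr q' s).
    by apply: cont_add => //; exact: cont_opp.
  apply: oint_bound => // s si; have s01 := in01 y01 x01 si.
  have sy : `|s - y| <= d.
    apply: le_trans xyd; move: si; clear; case: (leP y x) => xy /andP[s1 s2].
      by rewrite !ger0_norm ?subr_ge0// lerB.
    rewrite !ler0_norm ?subr_le0// ?(ltW xy)// !opprB.
    by rewrite lerB.
  rewrite /integrand /fr mulrA -mulrBl normrM ler_pM// ?dq'//.
  rewrite (_ : _ - _ = (w (s, q') - w (y, q0)) * z (s, th (s, q')) +
     w (y, q0) * (z (s, th (s, q')) - z (y, th (s, q')))); last by rewrite /zy; ring.
  apply: le_trans (ler_normD _ _) _; rewrite [leRHS]mulrDr; apply: lerD.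
    rewrite normrM mulrC ler_pM// ?zN//.
    have -> : w (s, q') - w (y, q0) = (w (s, q') - w (s, q0)) + (w (s, q0) - w (y, q0)) by ring.
    have -> : 2 * e1 = e1 + e1 by ring.
    by rewrite (le_trans (ler_normD _ _))// lerD// ?wq' ?wmod.
  rewrite normrM mulrCA ler_pM// ?wM//.
  by apply: le_trans (zL _ _ _ s01 y01) _; rewrite ler_wpM2l.
have JJ : `|J q0 - J q| <= N * (2 * M * e2).
  rewrite /J -mulrBr normrM.
  have h1 : `|Z (th (x, q)) - Z (th (x, q0))| <= N * e2.
    by apply: le_trans (Zlip _ _) _; rewrite ler_wpM2l// thq.
  have h2 : `|Z (th (y, q)) - Z (th (y, q0))| <= N * e2.
    by apply: le_trans (Zlip _ _) _; rewrite ler_wpM2l// thq.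
  have -> : N * (2 * M * e2) = M * (N * e2 + N * e2) by ring.
  rewrite ler_pM// ?wM//.
  rewrite (_ : _ - _ = (Z (th (y, q)) - Z (th (y, q0))) - (Z (th (x, q)) - Z (th (x, q0)))); last by ring.
  by apply: le_trans (ler_normB _ _) _; rewrite lerD.
have w00 s : 0 <= s <= 1 -> `|w (s, q0) - w (s, q0)| <= e1 by rewrite subrr normr0.
have h0 := IJ q0 w00 dM; have h := IJ q wq dMq.
rewrite (_ : _ - _ = (oint y x (integrand z q0) - J q0) + (J q0 - J q)
   - (oint y x (integrand z q) - J q)); last by ring.
apply: le_trans (ler_normB _ _) _.
apply: le_trans (lerD (ler_normD _ _) h) _.
apply: le_trans (lerD (lerD h0 JJ) (lexx _)) _.
by rewrite le_eqVlt; apply/orP; left; apply/eqP; ring.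
Qed.

Lemma oint_sum (h : R -> R) (y : nat -> R) (k : nat) : continuous h ->
  oint (y 0%N) (y k) h = \sum_(i < k) oint (y i) (y i.+1) h.
Proof.
move=> ch; elim: k => [|k IH]; first by rewrite big_ord0 ointxx.
by rewrite big_ord_recr /= -IH oint_cat.
Qed.

Lemma segment_bound (F : R * T -> R) (q0 : T) : continuous F ->
  exists2 M, 0 < M & \forall q \near q0, forall s, 0 <= s <= 1 -> `|F (s, q)| <= M.
Proof.
move=> cF.
have c : continuous (fun s => `|F (s, q0)|) by have cF0 := cont_slice (q := q0) cF; cont.
have [c0 _ cM] := EVT_max (ler01 : (0 : R) <= 1) (continuous_subspaceT c).
exists (`|F (c0, q0)| + 1); first by rewrite ltr_wpDl.
have := near_segment_dist 0 1 q0 cF ltr01.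
apply: filterS => q Hq s s01.
rewrite -[F (s, q)](subrK (F (s, q0))) (le_trans (ler_normD _ _))// addrC lerD ?Hq//.
by apply: cM; rewrite in_itv.
Qed.

Lemma uniform_modulus (F : R * T -> R) (q0 : T) (e : R) : continuous F -> 0 < e ->
  exists2 d, 0 < d & forall s s', 0 <= s <= 1 -> 0 <= s' <= 1 -> `|s - s'| <= d ->
    `|F (s, q0) - F (s', q0)| <= e.
Proof.
move=> cF e0; have cF0 := cont_slice (q := q0) cF.
pose F0 s := F (s, q0); have {}cF0 : continuous F0 := cF0.
have c : continuous (fun p : R * R => F0 (p.1 + p.2)) by cont.
have /nbhs_ballP[d d0 dP] := near_segment_dist 0 1 0 c e0.
exists (d / 2); first by rewrite divr_gt0.
move=> s s' s01 s'01 ss'; have := dP (s - s'); rewrite -ball_normE /= sub0r normrN.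
have dd : `|s - s'| < d by apply: le_lt_trans ss' _; rewrite ltr_pdivrMr// ltr_pMr// ltr1n.
by move=> /(_ dd s' s'01); rewrite addr0 subrKC.
Qed.

(** The segment is cut into [m] pieces. The freezing errors sum to something small for large [m];
    the end point errors are multiplied by [m], so [q] is brought close to [q0] only once [m] is
    fixed. As [z] enters only through the factor [N], the neighbourhood serves all [z]. *)
Lemma smoothing (q0 : T) (eps : R) : 0 < eps -> \forall q \near q0,
  forall N z y x, transported N z -> 0 <= y <= 1 -> 0 <= x <= 1 ->
  `|oint y x (integrand z q0) - oint y x (integrand z q)| <= N * eps.
Proof.
move=> eps0.
have [M1 M10 HM1] := segment_bound q0 cw.
have [M2 M20 HM2] := segment_bound q0 cdth.
pose M := M1 + M2; have M0 : 0 < M by rewrite addr_gt0.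
(* [e1], [m] and [e2] make each of the three error terms of [frozen_piece] at most [eps / (4 * m)],
   up to the factor [N]. *)
pose e1 := eps / (16 * M); have e10 : 0 < e1 by rewrite divr_gt0// mulr_gt0.
have [d d0 wmod] := uniform_modulus q0 cw e10.
pose m := (Num.bound (8 * M ^+ 2 / eps + d^-1)).+1.
have m0 : 0 < m%:R :> R by rewrite ltr0n.
have mB : 8 * M ^+ 2 / eps + d^-1 <= m%:R.
  have B0 : 0 <= 8 * M ^+ 2 / eps + d^-1.
    by rewrite addr_ge0// ?invr_ge0 ?divr_ge0 ?mulr_ge0 ?exprn_ge0// ltW.
  by apply: le_trans (ltW (archi_boundP B0)) _; rewrite ler_nat leqnSn.
have mB1 : 8 * M ^+ 2 / eps <= m%:R.
  by apply: le_trans mB; rewrite lerDl invr_ge0 ltW.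
have mB2 : m%:R^-1 <= d.
  rewrite invf_ple ?posrE//; apply: le_trans mB.
  by rewrite lerDr divr_ge0 ?mulr_ge0 ?exprn_ge0// ltW.
pose e2 := eps / (8 * m%:R * M); have e20 : 0 < e2 by rewrite divr_gt0// !mulr_gt0.
near=> q => N z y x tz y01 x01.
have [cz zN zL] := tz; have N0 : 0 <= N := le_trans (normr_ge0 _) (zN _ 0 y01).
pose Y (i : nat) : R := y + i%:R / m%:R * (x - y).
have Y0 : Y 0%N = y by rewrite /Y mul0r mul0r addr0.
have Ym : Y m = x by rewrite /Y divff ?gt_eqF// mul1r subrKC.
have Y01 i : (i <= m)%N -> 0 <= Y i <= 1.
  move=> im; have l0 : 0 <= i%:R / m%:R :> R by rewrite divr_ge0.
  have l1 : i%:R / m%:R <= 1 :> R by rewrite ler_pdivrMr// mul1r ler_nat.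
  rewrite /Y; move: l0 l1 y01 x01; set l := _ / _; clear.
  move=> l0 l1 /andP[y0 y1] /andP[x0 x1]; apply/andP; split; nra.
have YS i : Y i.+1 - Y i = m%:R^-1 * (x - y).
  by rewrite /Y -natr1 mulrDl mul1r; ring.
have ci q' := integrand_continuous (q := q') cz.
have SY q' : oint y x (integrand z q') =
    \sum_(i < m) oint (Y i) (Y i.+1) (integrand z q').
  by have := oint_sum Y m (ci q'); rewrite Y0 Ym.
rewrite !SY -sumrB.
apply: le_trans (ler_norm_sum _ _ _) _.
have xy1 : `|x - y| <= 1 by exact: dist01.
have step (i : 'I_m) : `|oint (Y i) (Y i.+1) (integrand z q0) -
    oint (Y i) (Y i.+1) (integrand z q)| <= N * (eps / m%:R).
  have i1 : (i <= m)%N by exact: ltnW.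
  have Yd : `|Y i.+1 - Y i| <= m%:R^-1.
    by rewrite YS normrM ger0_norm ?invr_ge0 ?ler_piMr// ?invr_ge0.
  have := @frozen_piece N M e1 e2 m%:R^-1 z q0 q (Y i) (Y i.+1) tz (Y01 _ i1) (Y01 _ (ltn_ord i)) Yd.
  move=> P; apply: le_trans (P _ _ _ _ _ _) _.
  - by move=> s s' s01 s'01 ss'; apply: wmod => //; exact: le_trans ss' mB2.
  - move=> s s01; apply: (@le_trans _ _ M1); last by rewrite lerDl ltW.
    exact: (nbhs_singleton HM1).
  - by near: q; exact: near_segment_dist.
  - move=> s s01; apply: (@le_trans _ _ M2); last by rewrite lerDr ltW.
    exact: (nbhs_singleton HM2).
  - move=> s s01; apply: (@le_trans _ _ M2); last by rewrite lerDr ltW.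
    by move: s s01; near: q.
  - by near: q; exact: near_segment_dist.
  rewrite ler_wpM2l//.
  have c0 : 0 <= 2 * (2 * e1 + M * m%:R^-1) * M.
    have h1 : 0 <= m%:R^-1 :> R by rewrite invr_ge0.
    by rewrite mulr_ge0 ?(ltW M0)// mulr_ge0// addr_ge0// mulr_ge0// ltW.
  apply: (@le_trans _ _ (2 * (2 * e1 + M * m%:R^-1) * M * m%:R^-1 + 2 * M * e2)).
    by rewrite lerD2r ler_wpM2l.
  have -> : 2 * M * e2 = (eps / 4) * m%:R^-1.
    by rewrite /e2; field; rewrite !gt_eqF.
  have -> : 2 * (2 * e1 + M * m%:R^-1) * M = eps / 4 + 2 * (M ^+ 2 / m%:R).
    by rewrite /e1; field; rewrite !gt_eqF.
  rewrite -mulrDl ler_wpM2r ?invr_ge0//.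
  have : 2 * (M ^+ 2 / m%:R) <= eps / 4.
    rewrite mulrA ler_pdivrMr//; move: mB1; rewrite ler_pdivrMr//.
    lra.
  lra.
apply: le_trans (ler_sum _ (fun i _ => step i)) _.
rewrite sumr_const card_ord -[leLHS]mulr_natr -mulrA divfK//.
by rewrite gt_eqF.
Unshelve. all: by end_near. Qed.

End smoothing.

(** * The hyperbolic system *)

Section derivative_criteria.
Context {R : realType}.

(** Together with [is_deriv01_eps] this gives a common form through which derivatives on the line
    and on the subspace [0, 1] are exchanged. *)
Lemma is_derive_eps (f : R -> R) (x l : R) : is_derive x (1 : R) f l <->
  forall e, 0 < e -> exists2 d, 0 < d & forall y, y != x -> `|y - x| < d ->
    `|l - (y - x)^-1 * (f y - f x)| <= e.
Proof.
split=> [D e e0|H].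
  have : h^-1 *: ((f \o shift x) (h *: (1 : R)) - f x) @[h --> 0^'] --> l.
    by have [dF dE] := D; rewrite -dE; exact: dF.
  move=> /cvgrPdist_le /(_ _ e0) /nbhs_ballP[d d0 dP]; exists d => // y yx yd.
  have := dP (y - x); rewrite -ball_normE /= sub0r normrN subr_eq0.
  move=> /(_ yd yx); rewrite /shift /=.
  have -> : (y - x) *: (1 : R) = y - x by exact: mulr1.
  by rewrite subrK.
have K : h^-1 *: ((f \o shift x) (h *: (1 : R)) - f x) @[h --> 0^'] --> l.
  apply/cvgrPdist_le => e /H[d d0 dP]; apply/nbhs_ballP; exists d => // h.
  rewrite -ball_normE /= sub0r normrN => hd h0.
  have -> : h *: (1 : R) = h by exact: mulr1.
  have := dP (h + x); rewrite addrK; apply=> //.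
  by rewrite -subr_eq0 addrK.
by apply: DeriveDef; [apply/cvg_ex; exists l|apply: cvg_lim].
Qed.

Lemma is_deriv01_eps (f : I01 R -> R^o) (x : I01 R) (l : R) : is_deriv01 f x l <->
  forall e, 0 < e -> exists2 d, 0 < d & forall y, val y != val x -> `|val y - val x| < d ->
    `|l - (val y - val x)^-1 * (f y - f x)| <= e.
Proof.
split=> [D e e0|H].
  have /cvgrPdist_le /(_ _ e0) /nbhs_ballP[d d0 dP] := D.
  exists d => // y yx yd; apply: (dP y); last by rewrite -val_eqE in yx *.
  by have : ball (val x) d (val y) by rewrite -ball_normE /= distrC.
apply/cvgrPdist_le => e /H[d d0 dP]; apply/nbhs_ballP; exists d => // y yd yx.
apply: dP; first by rewrite val_eqE.
by have : ball (val x) d (val y) := yd; rewrite -ball_normE /= distrC.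
Qed.

Lemma cont_eps {T : pseudoMetricType R} (f : T -> R) :
  (forall x e, 0 < e -> exists2 d : R, 0 < d & forall y, ball x d y -> `|f x - f y| <= e) ->
  continuous f.
Proof.
move=> H x; apply/cvgrPdist_le => e e0; apply/nbhs_ballP.
by have [d d0 dP] := H x e e0; exists d.
Qed.

Lemma is_deriv01_continuous (f : I01 R -> R^o) (l : I01 R -> R) :
  (forall x, is_deriv01 f x (l x)) -> continuous f.
Proof.
move=> D; apply: (@cont_eps (I01 R)) => x e e0.
have /is_deriv01_eps /(_ _ ltr01)[d d0 dP] := D x.
pose C := `|l x| + 1; have C0 : 0 < C by rewrite ltr_wpDl.
exists (Num.min d (e / C)).
  by rewrite lt_min d0 divr_gt0.
move=> y; have -> : ball x (Num.min d (e / C)) y = (`|val x - val y| < Num.min d (e / C)) :> Prop.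
  by rewrite -[LHS]/(ball (val x) (Num.min d (e / C)) (val y)) -ball_normE.
rewrite lt_min => /andP[yd ye].
have [yx|yx] := eqVneq (val y) (val x).
  by have -> : y = x; [exact: val_inj|rewrite subrr normr0 ltW].
have h := dP y yx; rewrite distrC in h; have {h} := h yd.
have yx0 : val y - val x != 0 by rewrite subr_eq0.
set q := _^-1 * _ => h.
have -> : f x - f y = - ((val y - val x) * q) by rewrite /q mulVKf// opprB.
rewrite normrN normrM.
have qC : `|q| <= C.
  have := ler_normB (l x) (l x - q); rewrite subKr => /le_trans; apply.
  by rewrite /C lerD2l.
rewrite distrC in ye; apply: le_trans (ler_wpM2l (normr_ge0 _) qC) _.
by rewrite -ler_pdivlMr// ltW.
Qed.

End derivative_criteria.

(** [Q] is the divided difference of [phi] in the initial value. Its continuity stands in for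
    differentiability there, the derivative being the value of [Q] on the diagonal [s1 = s2]. *)
Record is_flow {R : realType} (g : R * R -> R) (G : R) (phi : R * R * R -> R)
    (Q : R * R * R * R -> R) : Prop := IsFlow {
  fl_cont : continuous phi;
  fl_init : forall x t, phi (x, x, t) = t;
  fl_der : forall z x t, is_derive z (1 : R) (fun z => phi (z, x, t)) (g (z, phi (z, x, t)));
  fl_uniq : forall a b y x z, solves g a b y -> x \in `[a, b] -> z \in `[a, b] ->
    y z = phi (z, x, y x);
  fl_comp : forall x y z t, phi (z, y, phi (y, x, t)) = phi (z, x, t);
  fl_near : forall z x t, `|phi (z, x, t) - t| <= G * `|z - x|;
  fl_Qcont : continuous Q;
  fl_Qgt0 : forall p, 0 < Q p;
  fl_sub : forall z x s1 s2, phi (z, x, s1) - phi (z, x, s2) = (s1 - s2) * Q (z, x, s1, s2)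
}.

Lemma flow_exists {R : realType} (g dg : R * R -> R) (G L : R) :
  continuous g -> continuous dg ->
  (forall x s, is_derive s (1 : R) (fun s => g (x, s)) (dg (x, s))) ->
  (forall p, `|g p| <= G) -> (forall p, `|dg p| <= L) ->
  exists phi Q, is_flow g G phi Q.
Proof.
move=> cg cdg dgE gG dgL.
pose phi := flow cg cdg dgE gG dgL.
pose fq := flowq cg cdg dgE gG dgL.
have cphi : continuous phi by exact: flow_continuous.
have cfq : continuous fq by exact: flowq_continuous.
exists phi, (fun p => expR (oint p.1.1.2 p.1.1.1 (fun s => fq (s, (p.1.1.2, p.1.2, p.2))))).
split=> //.
- by move=> x t; exact: flow_xx.
- by move=> z x t; exact: flow_derive.
- by move=> a b y x z; exact: flow_uniq.
- by move=> x y z t; exact: flow_flow.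
- by move=> z x t; exact: flow_bound.
- apply: cont_exp.
  have c : continuous (fun z : R * (R * R * R * R) => fq (z.1, (z.2.1.1.2, z.2.1.2, z.2.2))) by cont.
  by apply: (cont_oint (f := fun p => p.1.1.2) (g := fun p => p.1.1.1) c); cont.
- by move=> p; exact: expR_gt0.
- by move=> z x s1 s2; exact: flow_diff.
Qed.

(** * The characteristics as restrictions of a flow *)

Section omega.
Context {R : realType} {n : nat} (a : 'I_n -> strip R -> R) (j : 'I_n).
Variables (g : R * R -> R) (G : R) (phi : R * R * R -> R) (Q : R * R * R * R -> R).
Hypothesis fl : is_flow g G phi Q.
Hypothesis gE : forall p, g p = (a j (clamp p.1, p.2))^-1.

(** The restricted flow shows that [xget] selects a genuine solution; extended by [clamp], this
    solution falls under the uniqueness statement of the flow. *)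
Lemma omegaE (x : I01 R) (t : R) (xi : I01 R) : omega a j x t xi = phi (val xi, val x, t).
Proof.
pose P := [set w : I01 R -> R | w x = t /\
    forall xi, is_deriv01 (w : I01 R -> R^o) xi (a j (xi, w xi))^-1].
have P0 : P (fun xi => phi (val xi, val x, t)).
  split; first exact: (fl_init fl).
  move=> z; apply/is_deriv01_eps => e e0.
  have /is_derive_eps /(_ _ e0)[d d0 dP] := fl_der fl (val z) (val x) t.
  exists d => // y yz yd; have := dP _ yz yd.
  by rewrite gE /= clamp_val.
have [wx wd] : P (omega a j x t) by apply: xgetPex; eexists; exact: P0.
pose w := omega a j x t; rewrite -/w in wx wd *.
have cw : continuous w := is_deriv01_continuous wd.
have cl := @clamp_continuous R.
pose y s := w (clamp s).
have sy : solves g 0 1 y.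
  split; first exact: (cont_comp cw cl).
  move=> s; rewrite in_itv/= => /andP[s0 s1].
  have sc : val (clamp s) = s by rewrite val_clamp_id// !ltW.
  apply/is_derive_eps => e e0.
  have /is_deriv01_eps /(_ _ e0)[d d0 dP] := wd (clamp s).
  (* Within this radius [u] stays in [0, 1], where [clamp] is the identity. *)
  exists (Num.min d (Num.min s (1 - s))).
    by rewrite !lt_min d0 s0 subr_gt0.
  move=> u us; rewrite !lt_min => /and3P[ud ud1 ud2].
  have uc : val (clamp u) = u.
    rewrite val_clamp_id//; move: ud1 ud2; rewrite !ltr_norml => /andP[? ?] /andP[? ?].
    by apply/andP; split; lra.
  have := dP (clamp u); rewrite uc sc => /(_ us ud).
  by rewrite gE.
have := fl_uniq fl (x := val x) (z := val xi) sy.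
rewrite /y !clamp_val wx; apply; rewrite in_itv; exact: val01.
Qed.

End omega.

Lemma finite_uniform_bound {R : realType} {I : finType} {T : Type} (F : I -> T -> R) :
  (forall i, exists M, forall p, F i p <= M) ->
  exists2 M, 0 <= M & forall i p, F i p <= M.
Proof.
move=> H; have [M MP] := choice H; exists (\sum_i `|M i|); first exact: sumr_ge0.
move=> i p; apply: le_trans (MP i p) _; apply: le_trans (ler_norm _) _.
by rewrite (bigD1 i)//= lerDl sumr_ge0.
Qed.

Lemma int01E {R : realType} (x y : I01 R) (g : I01 R -> R) (h : R -> R) :
  (forall xi, g xi = h (val xi)) -> int01 x y g = oint (val x) (val y) h.
Proof.
move=> gh; rewrite -[LHS]/(oint (val x) (val y) (fun s => g (to01 s))).
apply: eq_oint => s /andP[s1 s2]; rewrite gh val_to01//; apply/andP; split.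
  by apply: le_trans s1; rewrite le_min; case/andP: (val01 x) => -> _; case/andP: (val01 y).
by apply: le_trans s2 _; rewrite ge_max; case/andP: (val01 x) => _ ->; case/andP: (val01 y).
Qed.

Lemma cont_sum {R : realType} {T : topologicalType} {I : finType} (P : pred I)
  (f : I -> T -> R) :
  (forall i, continuous (f i)) -> continuous (fun x => \sum_(i | P i) f i x).
Proof.
move=> cf x; apply: cvg_big => [|i _]; [exact: add_continuous|exact: cf].
Qed.

Lemma oint_bigsum {R : realType} {I : finType} (P : pred I) (x y : R) (h : I -> R -> R) :
  (forall i, continuous (h i)) ->
  oint x y (fun s => \sum_(i | P i) h i s) = \sum_(i | P i) oint x y (h i).
Proof.
move=> ch; pose S (r : seq I) (s : R) := \sum_(i <- r | P i) h i s.
have cS r : continuous (S r).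
  by move=> s; apply: cvg_big => [|i _]; [exact: add_continuous|exact: ch].
rewrite -[LHS]/(oint x y (S (index_enum I))); elim: (index_enum I) => [|i r IH].
  have -> : S [::] = fun s => 0 * S [::] s.
    by apply/funext => s; rewrite /S !big_nil mulr0.
  by rewrite ointZ// mul0r big_nil.
rewrite big_cons; case: ifPn => Pi; last first.
  rewrite -IH; congr oint; apply/funext => s; by rewrite /S big_cons (negbTE Pi).
rewrite -IH -ointD//; congr oint; apply/funext => s.
by rewrite /S big_cons Pi.
Qed.

(** At a zero of [D] the product rule asks only continuity of [H], which is all that is known of [Q]
    in [crossing_derive]. *)
Lemma derive_mul_vanish {R : realType} (D H : R -> R) (x d : R) :
  is_derive x (1 : R) D d -> D x = 0 -> continuous H ->
  is_derive x (1 : R) (fun s => D s * H s) (d * H x).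
Proof.
move=> DD D0 cH.
have K1 : h^-1 *: ((D \o shift x) (h *: (1 : R)) - D x) @[h --> 0^'] --> d.
  by have [dF dE] := DD; rewrite -dE; exact: dF.
have K2 : H (h *: (1 : R) + x) @[h --> 0^'] --> H x.
  have c : continuous (fun h : R => H (h * 1 + x)) by cont.
  have := c 0; rewrite /continuous_at /= mul0r add0r => c0.
  exact: cvg_within_filter c0.
have K : h^-1 *: (((fun s => D s * H s) \o shift x) (h *: (1 : R)) - D x * H x)
    @[h --> 0^'] --> d * H x.
  have -> : (fun h : R => h^-1 *: (((fun s => D s * H s) \o shift x) (h *: (1 : R)) - D x * H x)) =
      (fun h => (h^-1 *: ((D \o shift x) (h *: (1 : R)) - D x)) * H (h *: (1 : R) + x)).
    by apply/funext => h; rewrite D0 mul0r !subr0 /= scalerAl.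
  exact: cvgM.
by apply: DeriveDef; [apply/cvg_ex; exists (d * H x)|apply: cvg_lim].
Qed.

Lemma rV_complete {R : realType} {n : nat} : cauchy_complete 'rV[R]_n.
Proof. by move=> F FF; exact: cauchy_cvg. Qed.

(** * The mild equation in operator form *)

Section system.
Context {R : realType} {n : nat} (m : nat).
Variables (a : 'I_n -> strip R -> R) (b : 'I_n -> 'I_n -> strip R -> R).
Variable Rb : {linear BC (strip R) 'rV[R]_n -> BC R 'rV[R]_n}.
Hypothesis bRb : bounded_op Rb.
Variables (phi : 'I_n -> R * R * R -> R) (Q : 'I_n -> R * R * R * R -> R) (G Bb : R).

Definition slowness j (p : R * R) : R := (a j (clamp p.1, p.2))^-1.
Notation g := slowness.

Hypothesis fl : forall j, is_flow (g j) G (phi j) (Q j).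
Hypothesis gG : forall j p, `|g j p| <= G.
Hypothesis a_neq0 : forall j p, a j p != 0.
Hypothesis ca : forall j, continuous (a j).
Hypothesis cb : forall j k, continuous (b j k).
Hypothesis bB : forall j k p, `|b j k p| <= Bb.

Local Notation Y := (BC (strip R) 'rV[R]_n).
Implicit Types (f u v : Y) (j k : 'I_n) (p : strip R).
Local Notation X j := (val (xbd m j : I01 R)).

Definition beta j (p : R * R) : R := b j j (clamp p.1, p.2) * g j p.

Definition cR j (p : R * R * R) : R :=
  expR (oint p.1.2 p.1.1 (fun s => beta j (s, phi j (s, p.1.2, p.2)))).

Definition dR j (p : R * R * R) : R := cR j p * g j (p.1.1, phi j p).

Lemma slowness_continuous j : continuous (g j).
Proof.
have c := ext_continuous (ca (j := j)).
by apply: cont_inv => // p; exact: a_neq0.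
Qed.

Lemma beta_continuous j : continuous (beta j).
Proof.
have c := ext_continuous (cb (j := j) (k := j)); have cg := @slowness_continuous j.
exact: cont_mul.
Qed.

Lemma cR_continuous j : continuous (cR j).
Proof.
have cbe := @beta_continuous j; have cp := fl_cont (fl j).
apply: cont_exp.
have c : continuous (fun z : R * (R * R * R) => beta j (z.1, phi j (z.1, z.2.1.2, z.2.2))).
  by cont.
have h1 : continuous (fun p : R * R * R => p.1.2) by cont.
have h2 : continuous (fun p : R * R * R => p.1.1) by cont.
exact: (cont_oint c h1 h2).
Qed.

Lemma dR_continuous j : continuous (dR j).
Proof.
have c1 := @cR_continuous j; have c2 := @slowness_continuous j; have cp := fl_cont (fl j).
have : continuous (fun p : R * R * R => cR j p * g j (p.1.1, phi j p)) by cont.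
exact.
Qed.

Definition Cmax : R := expR (Bb * G).

Lemma Cmax_gt0 : 0 < Cmax. Proof. exact: expR_gt0. Qed.

Lemma cR_bound j (xi x t : R) : 0 <= xi <= 1 -> 0 <= x <= 1 -> `|cR j (xi, x, t)| <= Cmax.
Proof.
move=> xi01 x01; rewrite gtr0_norm ?expR_gt0// /cR /Cmax ler_expR /=.
have c0 := is_derive_continuous (fun z => fl_der (fl j) z x t).
have cbe := @beta_continuous j.
have c : continuous (fun s => beta j (s, (fun s => phi j (s, x, t)) s)) by cont.
apply: le_trans (ler_norm _) _.
have bb0 : 0 <= Bb := le_trans (normr_ge0 _) (bB j j (clamp 0, 0)).
have gg0 : 0 <= G := le_trans (normr_ge0 _) (gG j (0, 0)).
apply: le_trans (oint_bound c (M := Bb * G) _) _.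
  by move=> s _; rewrite normrM ler_pM.
by rewrite ler_piMr ?mulr_ge0// dist01.
Qed.

Lemma dR_bound j (xi x t : R) : 0 <= xi <= 1 -> 0 <= x <= 1 ->
  `|dR j (xi, x, t)| <= Cmax * G.
Proof. by move=> xi01 x01; rewrite normrM ler_pM// cR_bound. Qed.

Lemma omega_phi j (x : I01 R) (t : R) (xi : I01 R) :
  omega a j x t xi = phi j (val xi, val x, t).
Proof. exact: (omegaE (fl j)). Qed.

Lemma ccE j (xi x : I01 R) t : cc a b j xi x t = cR j (val xi, val x, t).
Proof.
rewrite /cc /cR; congr expR; apply: int01E => eta.
by rewrite /= omega_phi /beta /slowness /= clamp_val.
Qed.

Lemma ddE j (xi x : I01 R) t : dd a b j xi x t = dR j (val xi, val x, t).
Proof. by rewrite /dd /dR ccE omega_phi /slowness /= clamp_val. Qed.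

Definition Freal f j (p : R * R) : R :=
  oint (X j) p.1 (fun s => dR j (s, p.1, p.2) * f (clamp s, phi j (s, p.1, p.2)) 0 j).

Lemma Fint_continuous f j (x t : R) :
  continuous (fun s => dR j (s, x, t) * f (clamp s, phi j (s, x, t)) 0 j).
Proof.
have c1 := @dR_continuous j; have c2 := fl_cont (fl j).
have c3 := @clamp_continuous R; pose F p := f p 0 j.
have c4 : continuous F := @cont_coord _ _ _ _ _ 0 j (bc_continuous (u := f)).
have : continuous (fun s => dR j (s, x, t) * F (clamp s, phi j (s, x, t))).
  by cont.
exact.
Qed.

Lemma Freal_continuous f j : continuous (Freal f j).
Proof.
have c1 := @dR_continuous j; have c2 := fl_cont (fl j).
have c3 := @clamp_continuous R; pose F p := f p 0 j.
have c4 : continuous F := @cont_coord _ _ _ _ _ 0 j (bc_continuous (u := f)).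
have c : continuous (fun z : R * (R * R) => dR j (z.1, z.2.1, z.2.2) *
  F (clamp z.1, phi j (z.1, z.2.1, z.2.2))) by cont.
have h1 : continuous (fun p : R * R => X j) by cont.
have h2 : continuous (fun p : R * R => p.1) by cont.
exact: (cont_oint c h1 h2).
Qed.

Lemma Freal_bound f j (x t : R) : 0 <= x <= 1 -> `|Freal f j (x, t)| <= Cmax * G * `|f|.
Proof.
move=> x01; have gg0 : 0 <= G := le_trans (normr_ge0 _) (gG j (0, 0)).
apply: le_trans (oint_bound (Fint_continuous (f := f) (j := j) (x := x) (t := t))
  (M := Cmax * G * `|f|) _) _.
  move=> s si; have s01 := in01 (val01 _) x01 si.
  rewrite normrM ler_pM// ?dR_bound//.
  exact: le_trans (mx_ler_coord _ _ _) (bc_ler_norm _ _).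
by rewrite ler_piMr// ?mulr_ge0// ?(ltW Cmax_gt0)// dist01// val01.
Qed.

(** Rules out the default value 0 of [toBC], once for [Fop], [Bop] and [Cop]. *)
Lemma toBC_row (F : 'I_n -> strip R -> R) (M : R) : 0 <= M ->
  (forall j, continuous (F j)) -> (forall j p, `|F j p| <= M) ->
  (forall p j, toBC (fun p => \row_j F j p) p 0 j = F j p) /\
  `|toBC (fun p => \row_j F j p)| <= M.
Proof.
move=> M0 cF FM.
have rM p : `|\row_j F j p| <= M.
  by apply: mx_norm_le => // i j; rewrite mxE.
have c : continuous (fun p => \row_j F j p).
  apply: cont_mx => i j; have -> : (fun p => (\row_j F j p) i j) = F j.
    by apply/funext => p; rewrite mxE.
  exact: cF.
have E p : toBC (fun p => \row_j F j p) p = \row_j F j p.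
  by apply: toBCE => //; exists M.
split; first by move=> p j; rewrite E mxE.
by apply: bc_norm_le => // p; rewrite E.
Qed.

Definition Fop f : Y := toBC (fun p => \row_j Freal f j (val p.1, p.2)).

Definition Bop u : Y := toBC (fun p => \row_j - \sum_(k < n | k != j) b j k p * u p 0 k).

(** The bound has [|G|] because [0 <= G] is derived from an index [j], and none is at hand for the
    norm. *)
Lemma FopP f : (forall p j, Fop f p 0 j = Freal f j (val p.1, p.2)) /\
  `|Fop f| <= Cmax * `|G| * `|f|.
Proof.
apply: toBC_row => [|j|j p].
- by rewrite !mulr_ge0// ltW// Cmax_gt0.
- exact: (res_continuous (Freal_continuous (f := f) (j := j))).
- have gg0 : 0 <= G := le_trans (normr_ge0 _) (gG j (0, 0)).
  by rewrite (ger0_norm gg0) Freal_bound// val01.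
Qed.

Lemma BopP u : (forall p j, Bop u p 0 j = - \sum_(k < n | k != j) b j k p * u p 0 k) /\
  `|Bop u| <= n%:R * `|Bb| * `|u|.
Proof.
apply: toBC_row => [|j|j p].
- by rewrite !mulr_ge0.
- apply: cont_opp; apply: cont_sum => k.
  have c1 := cb (j := j) (k := k).
  have c2 := @cont_coord _ _ _ _ _ 0 k (bc_continuous (u := u)).
  by apply: cont_mul.
- rewrite normrN; apply: le_trans (ler_norm_sum _ _ _) _.
  apply: (@le_trans _ _ (\sum_(k < n | k != j) (`|Bb| * `|u|))).
    apply: ler_sum => k _; rewrite normrM ler_pM//.
      exact: le_trans (bB _ _ _) (ler_norm _).
    exact: le_trans (mx_ler_coord _ _ _) (bc_ler_norm _ _).
  rewrite sumr_const -[leLHS]mulr_natl -[leRHS]mulrA ler_wpM2r ?mulr_ge0// ler_nat.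
  by rewrite -[leqRHS]card_ord max_card.
Qed.

Lemma bdtermE u p j : bdterm m a b Rb u p j =
  cR j (X j, val p.1, p.2) * Rb u (phi j (X j, val p.1, p.2)) 0 j.
Proof. by case: p => x t; rewrite /bdterm ccE omega_phi. Qed.

Lemma CopP u : (forall p j, Cop m a b Rb u p 0 j =
    cR j (X j, val p.1, p.2) * Rb u (phi j (X j, val p.1, p.2)) 0 j) /\
  `|Cop m a b Rb u| <= Cmax * `|Rb u|.
Proof.
have -> : Cop m a b Rb u = toBC (fun p => \row_j
    (cR j (X j, val p.1, p.2) * Rb u (phi j (X j, val p.1, p.2)) 0 j)).
  by congr toBC; apply/funext => p; apply/rowP => j; rewrite !mxE bdtermE.
apply: (@toBC_row (fun j p =>
  cR j (X j, val p.1, p.2) * Rb u (phi j (X j, val p.1, p.2)) 0 j)) => [|j|j p].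
- by rewrite mulr_ge0// ltW// Cmax_gt0.
- have c1 := @cR_continuous j; have c2 := fl_cont (fl j).
  pose F s := Rb u s 0 j.
  have c4 : continuous F := @cont_coord _ _ _ _ _ 0 j (bc_continuous (u := Rb u)).
  have c0 : continuous (fun q : R * R => (X j, q.1, q.2)) by cont.
  exact: (res_continuous (cont_mul (cont_comp c1 c0) (cont_comp c4 (cont_comp c2 c0)))).
- rewrite normrM ler_pM// ?cR_bound ?val01//.
  exact: le_trans (mx_ler_coord _ _ _) (bc_ler_norm _ _).
Qed.

Lemma bc_extP u v : (forall p j, u p 0 j = v p 0 j) <-> u = v.
Proof.
split=> [uv|-> //]; apply: bc_ext => p; apply/rowP => j; exact: uv.
Qed.

Lemma bc_linE {T : topologicalType} (k : R) (f h : BC T 'rV[R]_n) (q : T) j :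
  (k *: f + h) q 0 j = k * f q 0 j + h q 0 j.
Proof. by rewrite bc_addE bc_scaleE !mxE. Qed.

Lemma Freal_lin f h (k : R) j (p : R * R) : Freal (k *: f + h) j p = k * Freal f j p + Freal h j p.
Proof.
rewrite /Freal -ointZ; last exact: Fint_continuous.
rewrite -ointD; [|by apply: cont_mul; [exact: cont_cst|exact: Fint_continuous]
  |exact: Fint_continuous].
congr oint; apply/funext => s.
by rewrite bc_linE mulrDr mulrCA.
Qed.

Lemma Fop_linear : linear Fop.
Proof.
move=> k f h; apply/bc_extP => p j; rewrite [RHS]bc_linE.
have [E1 E2 E3] := And3 ((FopP (k *: f + h)).1 p j) ((FopP f).1 p j) ((FopP h).1 p j).
by rewrite [LHS]E1 E2 E3 Freal_lin.
Qed.

Lemma Bop_linear : linear Bop.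
Proof.
move=> l u v; apply/bc_extP => p j; rewrite [RHS]bc_linE !(BopP _).1.
rewrite mulrN -opprD mulr_sumr -big_split /=; congr (- _); apply: eq_bigr => k _.
by rewrite bc_linE mulrDr mulrCA.
Qed.

Lemma Cop_linear : linear (Cop m a b Rb).
Proof.
move=> k f h; apply/bc_extP => p j; rewrite [RHS]bc_linE !(CopP _).1.
by rewrite linearP bc_linE mulrDr mulrCA.
Qed.

Lemma bc_solutionE f u : bc_solution m a b Rb f u <->
  u = Cop m a b Rb u + Fop (Bop u + f).
Proof.
have E x t j : bdterm m a b Rb u (x, t) j
      - int01 (xbd m j) x (fun xi => dd a b j xi x t *
          \sum_(k < n | k != j) b j k (xi, omega a j x t xi) * u (xi, omega a j x t xi) 0 k)
      + int01 (xbd m j) x (fun xi => dd a b j xi x t * f (xi, omega a j x t xi) 0 j) =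
    (Cop m a b Rb u + Fop (Bop u + f)) (x, t) 0 j.
  rewrite bc_addE !mxE (CopP u).1 (FopP _).1 bdtermE /= -addrA; congr (_ + _).
  rewrite -{1}[Bop u]scale1r Freal_lin mul1r; congr (_ + _).
    rewrite (@int01E R _ _ _ (fun s => - 1 * (dR j (s, val x, t) *
       Bop u (clamp s, phi j (s, val x, t)) 0 j))).
      by rewrite ointZ ?mulN1r ?opprK//; exact: Fint_continuous.
    move=> xi; rewrite ddE omega_phi (BopP u).1 clamp_val /=.
    by rewrite mulrN mulN1r opprK.
  apply: int01E => xi.
  by rewrite ddE omega_phi clamp_val.
split=> [sol|uE].
  by apply/bc_extP => -[x t] j; rewrite sol E.
by move=> j x t /=; rewrite E; exact: (congr1 (fun v : Y => v (x, t) 0 j) uE).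
Qed.


(** * Smoothing and decay of F B (1 - C)^-1 F *)

Variable bt : 'I_n -> 'I_n -> strip R -> R.
Hypothesis cbt : forall j k, continuous (bt j k).
Hypothesis b_bt : forall j k p, j != k -> b j k p = bt j k p * (a k p - a j p).
Hypothesis b_decay : forall eps : R, 0 < eps -> exists s1 s2 : R, s1 <= s2 /\
  forall j k (x : I01 R) (t : R), j != k -> t \notin `[s1, s2] -> `|b j k (x, t)| < eps.

(* The second argument labels a k-characteristic by its value at x_k. *)
Definition profile v f k (p : R * R) : R := Rb v p.2 0 k +
  oint (X k) p.1 (fun s => dR k (s, X k, p.2) * f (clamp s, phi k (s, X k, p.2)) 0 k).

Lemma cR_cocycle k (s x t : R) :
  cR k (s, x, t) = cR k (X k, x, t) * cR k (s, X k, phi k (X k, x, t)).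
Proof.
have c0 := is_derive_continuous (fun z => fl_der (fl k) z x t).
have cbe := @beta_continuous k.
have c : continuous (fun s => beta k (s, (fun s => phi k (s, x, t)) s)) by cont.
rewrite /cR /= -expRD; congr expR.
rewrite -(oint_cat x (X k) s c); congr (_ + _); congr oint.
by apply/funext => u; rewrite (fl_comp (fl k)).
Qed.

(** By [cR_cocycle] the factor [cR k (X k, x, t)] comes out of boundary term and integral alike;
    what remains depends on [t] only through the label of the characteristic. *)
Lemma mild_profile v f p k : v = Cop m a b Rb v + Fop f ->
  v p 0 k = cR k (X k, val p.1, p.2) *
    profile v f k (val p.1, phi k (X k, val p.1, p.2)).
Proof.
move=> vE; have -> : v p 0 k = Cop m a b Rb v p 0 k + Fop f p 0 k.
  by rewrite [in LHS]vE bc_addE mxE.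
rewrite (CopP v).1 (FopP f).1 /profile /= mulrDr -ointZ; last exact: Fint_continuous.
congr (_ + _); rewrite /Freal /=; congr oint; apply/funext => s.
by rewrite (fl_comp (fl k)) mulrA /dR (cR_cocycle k s) /= (fl_comp (fl k)) mulrA.
Qed.

Lemma profile_transported v f k (N MR : R) : 0 <= N -> `|v| <= N -> `|f| <= N ->
  0 <= MR -> (forall u, `|Rb u| <= MR * `|u|) ->
  transported ((MR + Cmax * G) * N) (profile v f k).
Proof.
move=> N0 vN fN MR0 RbM.
have gg0 : 0 <= G := le_trans (normr_ge0 _) (gG k (0, 0)).
have cmg : 0 <= Cmax * G by rewrite mulr_ge0// ltW// Cmax_gt0.
have X01 := val01 (xbd m k : I01 R).
have intb s (u : R) : 0 <= s <= 1 ->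
    `|dR k (s, X k, u) * f (clamp s, phi k (s, X k, u)) 0 k| <= Cmax * G * N.
  move=> s01; rewrite normrM ler_pM// ?dR_bound//.
  exact: le_trans (mx_ler_coord _ _ _) (le_trans (bc_ler_norm _ _) fN).
split.
- have c1 := @dR_continuous k; have c2 := fl_cont (fl k); have c3 := @clamp_continuous R.
  pose F p := f p 0 k; pose H s := Rb v s 0 k.
  have c4 : continuous F := @cont_coord _ _ _ _ _ 0 k (bc_continuous (u := f)).
  have c5 : continuous H := @cont_coord _ _ _ _ _ 0 k (bc_continuous (u := Rb v)).
  have c : continuous (fun z : R * (R * R) => dR k (z.1, X k, z.2.2) *
    F (clamp z.1, phi k (z.1, X k, z.2.2))) by cont.
  have h1 : continuous (fun p : R * R => X k) by cont.
  have h2 : continuous (fun p : R * R => p.1) by cont.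
  have h3 : continuous (fun p : R * R => H p.2) by cont.
  exact: (cont_add h3 (cont_oint c h1 h2)).
- move=> s u s01; rewrite mulrDl; apply: le_trans (ler_normD _ _) _; apply: lerD => /=.
    apply: le_trans (mx_ler_coord _ _ _) _; apply: le_trans (bc_ler_norm _ _) _.
    by apply: le_trans (RbM v) _; rewrite ler_wpM2l.
  apply: le_trans (oint_bound (Fint_continuous (f := f) (j := k) (x := X k) (t := u))
    (M := Cmax * G * N) _) _.
    by move=> s' si; apply: intb; exact: in01 X01 s01 si.
  by rewrite ler_piMr//; [exact: mulr_ge0|exact: dist01].
- move=> s s' u s01 s'01; rewrite /profile /= opprD addrACA subrr add0r.
  have c := Fint_continuous (f := f) (j := k) (x := X k) (t := u).
  rewrite -(oint_cat (X k) s' s c) addrAC subrr add0r.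
  apply: le_trans (oint_bound c (M := Cmax * G * N) _) _.
    by move=> r ri; apply: intb; exact: in01 s'01 s01 ri.
  by rewrite ler_wpM2r// ler_wpM2r// lerDr.
Qed.

(** The label, at x_k, of the k-characteristic met at abscissa [p.1] by the j-characteristic through
    [p.2]. *)
Definition crossing j k (p : R * (R * R)) : R :=
  phi k (X k, p.1, phi j (p.1, p.2.1, p.2.2)).

(** The relative slope of the two characteristics, carried to x_k by the derivative of the k-flow in
    its initial value. *)
Definition dcrossing j k (p : R * (R * R)) : R :=
  let y := phi j (p.1, p.2.1, p.2.2) in
  (g j (p.1, y) - g k (p.1, y)) * Q k (X k, p.1, y, y).

(* d crossing = Q (1 / a_j - 1 / a_k) ds and b_jk = bt_jk (a_k - a_j), so this
   weight turns the integrand of F B v into weight * profile * d crossing. *)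
Definition weight j k (p : R * (R * R)) : R :=
  let y := phi j (p.1, p.2.1, p.2.2) in
  dR j (p.1, p.2.1, p.2.2) * (bt j k (clamp p.1, y) * (a j (clamp p.1, y) * a k (clamp p.1, y)))
  * cR k (X k, p.1, y) * (Q k (X k, p.1, y, y))^-1.

Lemma weight_continuous j k : continuous (weight j k).
Proof.
have c1 := @dR_continuous j; have c2 := fl_cont (fl j); have c3 := @clamp_continuous R.
have c4 := cbt (j := j) (k := k); have c5 := ca (j := j); have c6 := ca (j := k).
have c7 := @cR_continuous k.
have c8 : continuous (fun z => (Q k z)^-1).
  apply: cont_inv; last exact: fl_Qcont (fl k).
  by move=> z; rewrite gt_eqF// (fl_Qgt0 (fl k)).
pose Y (z : R * (R * R)) := phi j (z.1, z.2.1, z.2.2).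
have cY : continuous Y.
  have : continuous (fun p : R * (R * R) => phi j (p.1, p.2.1, p.2.2)) by cont.
  exact.
pose QI z := (Q k z)^-1; have cQI : continuous QI := c8.
have : continuous (fun p : R * (R * R) => dR j (p.1, p.2.1, p.2.2) *
  (bt j k (clamp p.1, Y p) * (a j (clamp p.1, Y p) * a k (clamp p.1, Y p)))
  * cR k (X k, p.1, Y p) * QI (X k, p.1, Y p, Y p)) by clear c8; cont.
exact.
Qed.

Lemma crossing_continuous j k : continuous (crossing j k).
Proof.
have c2 := fl_cont (fl j); have c3 := fl_cont (fl k).
have : continuous (fun p : R * (R * R) => phi k (X k, p.1, phi j (p.1, p.2.1, p.2.2))) by cont.
exact.
Qed.

Lemma dcrossing_continuous j k : continuous (dcrossing j k).
Proof.
have c2 := fl_cont (fl j); have c3 := fl_Qcont (fl k).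
have c4 := @slowness_continuous j; have c5 := @slowness_continuous k.
have : continuous (fun p : R * (R * R) => (g j (p.1, phi j (p.1, p.2.1, p.2.2)) -
  g k (p.1, phi j (p.1, p.2.1, p.2.2))) *
  Q k (X k, p.1, phi j (p.1, p.2.1, p.2.2), phi j (p.1, p.2.1, p.2.2))) by cont.
exact.
Qed.

(** Near [s] the j-characteristic [y] is compared with the k-characteristic [kap] through the same
    point. Since [kap] keeps its label, the label of [y] changes by [(y - kap) * Q], whose first
    factor vanishes at [s]. *)
Lemma crossing_derive j k s q :
  is_derive s (1 : R) (fun s => crossing j k (s, q)) (dcrossing j k (s, q)).
Proof.
pose y (u : R) := phi j (u, q.1, q.2); pose kap (u : R) := phi k (u, s, y s).
have yD : is_derive s (1 : R) y (g j (s, y s)) := fl_der (fl j) s q.1 q.2.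
have ks : kap s = y s by rewrite /kap (fl_init (fl k)).
have kD : is_derive s (1 : R) kap (g k (s, y s)).
  by rewrite -[in Z in is_derive _ _ _ Z]ks; exact: (fl_der (fl k)).
have cy : continuous y := is_derive_continuous (fun z => fl_der (fl j) z q.1 q.2).
have ck : continuous kap := is_derive_continuous (fun z => fl_der (fl k) z s (y s)).
have cQ := fl_Qcont (fl k).
have E : (fun u : R => crossing j k (u, q)) = fun u : R => phi k (X k, s, y s) +
    (y u - kap u) * Q k (X k, u, y u, kap u).
  apply/funext => u; rewrite -(fl_sub (fl k)) /kap (fl_comp (fl k)).
  by rewrite subrKC.
have D0 := is_derive_cst (phi k (X k, s, y s)) s (1 : R).
rewrite E -[dcrossing _ _ _]add0r; apply: (derive_add D0).
have -> : dcrossing j k (s, q) = (g j (s, y s) - g k (s, y s)) * Q k (X k, s, y s, kap s).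
  by rewrite ks.
apply: (derive_mul_vanish (derive_sub yD kD)); first by rewrite ks subrr.
have : continuous (fun u : R => Q k (X k, u, y u, kap u)) by cont.
exact.
Qed.

Lemma Fint_Bop v f j q (y x : R) : v = Cop m a b Rb v + Fop f ->
  0 <= y <= 1 -> 0 <= x <= 1 ->
  oint y x (fun s => dR j (s, q.1, q.2) * Bop v (clamp s, phi j (s, q.1, q.2)) 0 j) =
  - \sum_(k < n | k != j) oint y x (integrand (weight j k) (crossing j k) (dcrossing j k)
      (profile v f k) q).
Proof.
move=> vE y01 x01.
have cP k : continuous (profile v f k).
  have [MR [MR0 RM]] := bounded_opP bRb.
  have N0 : 0 <= `|v| + `|f| by rewrite addr_ge0.
  have vN : `|v| <= `|v| + `|f| by rewrite lerDl.
  have fN : `|f| <= `|v| + `|f| by rewrite lerDr.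
  by have [] := @profile_transported v f k _ MR N0 vN fN (ltW MR0) RM.
have ci k := integrand_continuous (@weight_continuous j k) (@crossing_continuous j k)
  (@dcrossing_continuous j k) (q := q) (cP k).
rewrite -oint_bigsum// -mulN1r -ointZ; last by apply: cont_sum.
apply: eq_oint => s si; have s01 := in01 y01 x01 si.
rewrite (BopP v).1 mulN1r mulrN mulr_sumr; congr (- _); apply: eq_bigr => k kj.
rewrite (mild_profile _ _ vE) /= val_clamp_id//.
rewrite b_bt 1?eq_sym// /integrand /weight /dcrossing /crossing /slowness /=.
set Y := phi j _; set P := profile _ _ _ _; set D := dR _ _.
have Q0 : Q k (X k, s, Y, Y) != 0 by rewrite gt_eqF// (fl_Qgt0 (fl k)).
(* The factors [a_j * a_k] and [Q^-1] of [weight] cancel against [dcrossing] and leave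
   [bt * (a_k - a_j)]. *)
by field; rewrite Q0 !a_neq0.
Qed.

Lemma FB_equicontinuous (eps : R) (p0 : strip R) : 0 < eps -> \forall p \near p0,
  forall v f N, v = Cop m a b Rb v + Fop f -> 0 <= N -> `|v| <= N -> `|f| <= N ->
  `|Fop (Bop v) p0 - Fop (Bop v) p| <= eps * N.
Proof.
move=> eps0; have [MR [MR0 RM]] := bounded_opP bRb.
pose K0 := MR + Cmax * `|G|; pose K1 := Cmax * `|G| * (n%:R * `|Bb|).
have K00 : 0 <= K0 by rewrite addr_ge0 ?mulr_ge0// ltW// Cmax_gt0.
have K10 : 0 <= K1 by rewrite !mulr_ge0// ltW// Cmax_gt0.
have nK0 : 0 <= n%:R * K0 by rewrite mulr_ge0.
(* [n%:R * K0] pays for moving the parameter in at most [n] crossing integrals, [K1] for moving the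
   upper limit; 1 keeps [K] positive. *)
pose K := n%:R * K0 + K1 + 1; have Kgt0 : 0 < K by rewrite ltr_wpDl// addr_ge0.
pose e := eps / K; have e0 : 0 < e by rewrite divr_gt0.
pose q0 : R * R := (val p0.1, p0.2).
pose good (jk : 'I_n * 'I_n) (q : R * R) := forall (N : R) z (y x : R),
  transported N z -> 0 <= y <= 1 -> 0 <= x <= 1 ->
  `|oint y x (integrand (weight jk.1 jk.2) (crossing jk.1 jk.2) (dcrossing jk.1 jk.2) z q0) -
    oint y x (integrand (weight jk.1 jk.2) (crossing jk.1 jk.2) (dcrossing jk.1 jk.2) z q)|
    <= N * e.
have near1 : \forall q \near q0, forall jk, good jk q.
  apply: (@filter_forall _ _ good (nbhs q0) (nbhs_filter q0)) => -[j k].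
  exact: (smoothing (@weight_continuous j k) (@crossing_continuous j k)
    (@dcrossing_continuous j k) (@crossing_derive j k) q0 e0).
pose r (p : strip R) : R * R := (val p.1, p.2).
have cr : continuous r.
  exact: (cont_pair (cont_comp val_continuous (cont_fst (@cont_id (strip R))))
    (cont_snd (@cont_id (strip R)))).
have near2 : \forall p \near p0, forall jk, good jk (r p) by exact: (cr p0 _ near1).
have near3 : \forall p \near p0, `|val p0.1 - val p.1| <= e.
  have c1 := cont_comp val_continuous (cont_fst (@cont_id (strip R))).
  by have /cvgrPdist_le /(_ _ e0) := c1 p0.
near=> p => v f N vE N0 vN fN.
have pe : `|val p0.1 - val p.1| <= e by near: p.
have pgood : forall jk, good jk (r p) by near: p.
have x001 := val01 p0.1; have x01 := val01 p.1.
apply: mx_norm_le => [|i j]; first by rewrite mulr_ge0// ltW.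
rewrite ord1 !mxE (FopP _).1 (FopP _).1 /Freal.
have gg0 : 0 <= G := le_trans (normr_ge0 _) (gG j (0, 0)).
have X01 := val01 (xbd m j : I01 R).
pose h (q : R * R) s := dR j (s, q.1, q.2) * Bop v (clamp s, phi j (s, q.1, q.2)) 0 j.
have ch q : continuous (h q) by exact: Fint_continuous.
rewrite -[oint _ _ _]/(oint (X j) (val p0.1) (h q0)).
rewrite -[Z in _ - Z]/(oint (X j) (val p.1) (h (r p))).
(* [smoothing] compares parameters over the same segment; the leftover segment is short and its
   integrand bounded. *)
rewrite -(oint_cat (X j) (val p0.1) (val p.1) (ch (r p))) opprD addrA.
apply: le_trans (ler_normB _ _) _.
have part1 : `|oint (X j) (val p0.1) (h q0) - oint (X j) (val p0.1) (h (r p))| <=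
    n%:R * K0 * N * e.
  rewrite (Fint_Bop j q0 vE X01 x001) (Fint_Bop j (r p) vE X01 x001) -opprD normrN -sumrB.
  apply: le_trans (ler_norm_sum _ _ _) _.
  have step k : `|oint (X j) (val p0.1) (integrand (weight j k) (crossing j k) (dcrossing j k)
      (profile v f k) q0) - oint (X j) (val p0.1) (integrand (weight j k) (crossing j k)
      (dcrossing j k) (profile v f k) (r p))| <= K0 * N * e.
    apply: (pgood (j, k)) => //.
    by rewrite /K0 (ger0_norm gg0); apply: profile_transported => //; exact: ltW.
  apply: le_trans (ler_sum _ (fun k _ => step k)) _.
  have KNe : 0 <= K0 * (N * e) by apply: mulr_ge0 => //; apply: mulr_ge0 => //; exact: ltW.
  rewrite sumr_const -[leLHS]mulr_natl -!mulrA ler_wpM2r//.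
  by rewrite ler_nat -[leqRHS]card_ord max_card.
have part2 : `|oint (val p0.1) (val p.1) (h (r p))| <= K1 * N * e.
  apply: le_trans (oint_bound (ch (r p)) (M := K1 * N) _) _.
    move=> s si; have s01 := in01 x001 x01 si.
    rewrite /h normrM /K1 -mulrA ler_pM//.
      by rewrite (ger0_norm gg0) dR_bound.
    apply: le_trans (mx_ler_coord _ _ _) _; apply: le_trans (bc_ler_norm _ _) _.
    by apply: le_trans (BopP v).2 _; rewrite ler_wpM2l// mulr_ge0.
  by rewrite distrC ler_wpM2l// mulr_ge0.
apply: le_trans (lerD part1 part2) _.
rewrite -!mulrDl mulrAC -/e ler_wpM2r//.
by rewrite /e mulrCA ger_pMr// ler_pdivrMr// mul1r /K lerDl.
Unshelve. all: by end_near. Qed.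

(** Over the unit interval a characteristic moves by at most [G] in time, so for large [|t|] it
    avoids the interval outside which the b_jk are small. *)
Lemma FB_decay (eps : R) : 0 < eps -> exists M, forall p v, M <= `|p.2| ->
  `|Fop (Bop v) p| <= eps * `|v|.
Proof.
move=> eps0; pose K := Cmax * `|G| * n%:R.
have K0 : 0 <= K by rewrite !mulr_ge0// ltW// Cmax_gt0.
have e0 : 0 < eps / (K + 1) by rewrite divr_gt0// ltr_wpDl.
have [s1 [s2 [s12 bs]]] := b_decay e0.
exists (`|s1| + `|s2| + `|G| + 1) => p v pM.
apply: mx_norm_le => [|i j]; first by rewrite mulr_ge0// ltW.
rewrite ord1 (FopP _).1 /Freal.
have gg0 : 0 <= G := le_trans (normr_ge0 _) (gG j (0, 0)).
have X01 := val01 (xbd m j : I01 R); have x01 := val01 p.1.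
have c := Fint_continuous (f := Bop v) (j := j) (x := val p.1) (t := p.2).
apply: le_trans (oint_bound c (M := K * (eps / (K + 1)) * `|v|) _) _; last first.
  have h0 : 0 <= K * (eps / (K + 1)) * `|v|.
    by apply: mulr_ge0 => //; apply: mulr_ge0 => //; exact: ltW.
  apply: le_trans (ler_piMr h0 (dist01 x01 X01)) _.
  rewrite ler_wpM2r// mulrCA ger_pMr// ler_pdivrMr ?ltr_wpDl//.
  by rewrite mul1r lerDl.
move=> s si; have s01 := in01 X01 x01 si.
have -> : K * (eps / (K + 1)) * `|v| = Cmax * G * (n%:R * (eps / (K + 1) * `|v|)).
  by rewrite {1}/K (ger0_norm gg0) !mulrA.
rewrite normrM ler_pM// ?dR_bound//.
rewrite (BopP v).1 normrN; apply: le_trans (ler_norm_sum _ _ _) _.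
set t := phi j _.
have tnear : `|t - p.2| <= G.
  apply: le_trans (fl_near (fl j) _ _ _) _.
  by rewrite ler_piMr// dist01.
have tout : t \notin `[s1, s2].
  rewrite in_itv/=; apply/negP => st; move: pM; rewrite leNgt => /negP; apply.
  by rewrite (ger0_norm gg0); exact: segment_near_bound tnear.
have step (k : 'I_n) : k != j -> `|b j k (clamp s, t) * v (clamp s, t) 0 k| <= eps / (K + 1) * `|v|.
  move=> kj; rewrite normrM ler_pM//; last first.
    exact: le_trans (mx_ler_coord _ _ _) (bc_ler_norm _ _).
  by apply: ltW; apply: bs => //; rewrite eq_sym.
apply: le_trans (ler_sum _ (fun k kj => step k kj)) _.
have h0 : 0 <= eps / (K + 1) * `|v| by rewrite mulr_ge0// ltW.
rewrite sumr_const -[leLHS]mulr_natl ler_wpM2r//.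
by rewrite ler_nat -[leqRHS]card_ord max_card.
Qed.

Lemma FB_finite_rank (V : {linear Y -> Y}) : bounded_op V ->
  (forall f, V f = Cop m a b Rb (V f) + Fop f) ->
  exists2 W : {linear Y -> Y}, (forall f, W f = Fop (Bop (V f))) & finite_rank_approx W.
Proof.
move=> /bounded_opP[K [K0 VK]] VE.
have [F FE] := linear_pack Fop_linear; have [B BE] := linear_pack Bop_linear.
have [W WE] : {z : {linear Y -> Y} | forall f, z f = F (B (V f))}.
  by apply: linear_pack => u x y; rewrite !linearP.
have {}WE f : W f = Fop (Bop (V f)) by rewrite WE FE BE.
exists W => //; apply: equicontinuous_finite_rank.
- exists (Cmax * `|G| * (n%:R * `|Bb| * K)) => f; rewrite WE.
  have c0 : 0 <= Cmax * `|G| by rewrite mulr_ge0// ltW// Cmax_gt0.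
  apply: le_trans (FopP _).2 _; rewrite -[leRHS]mulrA ler_wpM2l//.
  apply: le_trans (BopP _).2 _; rewrite -[leRHS]mulrA.
  by apply: ler_wpM2l; [exact: mulr_ge0|exact: VK].
(* [(K + 1) * |f|] dominates both [|V f|] and [|f|]. *)
- move=> e e0 p0; have e1 : 0 < e / (K + 1) by rewrite divr_gt0// ltr_wpDl// ltW.
  apply: filterS (FB_equicontinuous p0 e1) => p H f; rewrite !WE.
  have fK : `|f| <= (K + 1) * `|f| by rewrite ler_peMl// lerDr ltW.
  have VfK : `|V f| <= (K + 1) * `|f|.
    by apply: le_trans (VK f) _; rewrite ler_wpM2r// lerDl.
  have N0 : 0 <= (K + 1) * `|f| := le_trans (normr_ge0 _) fK.
  have := H (V f) f _ (VE f) N0 VfK fK.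
  by rewrite mulrA divfK// gt_eqF// ltr_wpDl// ltW.
- move=> e e0; have e1 : 0 < e / K by rewrite divr_gt0.
  have [M MP] := FB_decay e1; exists M => p f pM; rewrite WE.
  apply: le_trans (MP p (V f) pM) _.
  rewrite -ler_pdivlMl ?divr_gt0// invf_div mulrA divfK ?gt_eqF//.
  exact: VK.
Qed.

Theorem system_fredholm :
  (exists l : nat, (opnorm (iter l (Cop m a b Rb)) < 1%:E)%E) ->
  exists d, [/\ has_dim [set u : Y | bc_solution m a b Rb 0 u] d,
    closed [set f | exists u, bc_solution m a b Rb f u] &
    has_codim [set f | exists u, bc_solution m a b Rb f u] d].
Proof.
move=> [l Cl].
have [C CE] := linear_pack Cop_linear.
have [F FE] := linear_pack Fop_linear; have [B BE] := linear_pack Bop_linear.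
have bF : bounded_op F.
  by exists (Cmax * `|G|) => f; rewrite FE (FopP f).2.
have bB' : bounded_op B.
  by exists (n%:R * `|Bb|) => u; rewrite BE (BopP u).2.
have bC : bounded_op C.
  have [MR [MR0 RM]] := bounded_opP bRb.
  exists (Cmax * MR) => u; rewrite CE; apply: le_trans (CopP u).2 _.
  by rewrite -mulrA ler_wpM2l// ltW// Cmax_gt0.
have {}Cl : (opnorm (iter l C) < 1%:E)%E.
  by rewrite (_ : (C : Y -> Y) = Cop m a b Rb)//; apply/funext => u; rewrite CE.
have approx (V : {linear Y -> Y}) : bounded_op V -> (forall f, V f = C (V f) + F f) ->
    exists2 W : {linear Y -> Y}, (forall f, W f = F (B (V f))) & finite_rank_approx W.
  move=> bV VE; have [|W WE aW] := FB_finite_rank bV.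
    by move=> f; rewrite -CE -FE.
  by exists W => // f; rewrite WE FE BE.
have [d [dK cS cdS]] := @mild_fredholm R Y C F B l (bc_complete rV_complete) bC bF bB' Cl approx.
have kE : [set u : Y | bc_solution m a b Rb 0 u] = [set u | u = C u + F (B u)].
  apply/seteqP; split=> u /=; rewrite CE FE BE.
    by move=> /bc_solutionE; rewrite addr0.
  by move=> uE; apply/bc_solutionE; rewrite addr0.
have sE : [set f | exists u, bc_solution m a b Rb f u] =
    [set f | exists u, u = C u + F (B u + f)].
  apply/seteqP; split=> f [u] uE; exists u.
    by move/bc_solutionE: uE; rewrite CE FE BE.
  by apply/bc_solutionE; rewrite -CE -FE -BE.
by exists d; rewrite kE sE.
Qed.

Lemma bc_solution_lin (k : R) f f' u u' : bc_solution m a b Rb f u ->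
  bc_solution m a b Rb f' u' -> bc_solution m a b Rb (k *: f + f') (k *: u + u').
Proof.
move=> /bc_solutionE uE /bc_solutionE u'E; apply/bc_solutionE.
have [C CE] := linear_pack Cop_linear.
have [F FE] := linear_pack Fop_linear; have [B BE] := linear_pack Bop_linear.
rewrite -CE -BE -FE in uE; rewrite -CE -BE -FE in u'E; rewrite -CE -BE -FE.
rewrite (linearP C) (linearP B).
have -> : k *: B u + B u' + (k *: f + f') = k *: (B u + f) + (B u' + f').
  by rewrite scalerDr addrACA.
by rewrite (linearP F) addrACA -scalerDr -uE -u'E.
Qed.

End system.

(** * Bounds on the coefficients and conclusion *)

Section coefficients.
Context {R : realType}.

(** Boundedness of [u] matters because the real-valued [inf] and [sup] are bounds only of bounded
    sets. *)
Lemma bounded_away (u : strip R -> R) : bounded_continuous (u : strip R -> R^o) ->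
  0 < inf (range u) \/ sup (range u) < 0 ->
  exists2 c, 0 < c & forall p, c <= `|u p|.
Proof.
move=> [_ /bounded_funE[M uM]] [u0|u0].
  exists (inf (range u)) => // p; apply: le_trans (ler_norm _).
  apply: ge_inf; last by exists p.
  by exists (- M) => _ [q _ <-]; have := uM q; rewrite ler_norml => /andP[].
exists (- sup (range u)); first by rewrite oppr_gt0.
move=> p; rewrite -normrN; apply: le_trans (ler_norm _); rewrite lerN2.
apply: ub_le_sup; last by exists p.
by exists M => _ [q _ <-]; have := uM q; rewrite ler_norml => /andP[].
Qed.

Lemma BC1_dt_continuous (u : strip R -> R) : BC1 (u : strip R -> R^o) ->
  continuous (dt (u : strip R -> R^o) : strip R -> R).
Proof. by case=> _ _ _ _ []. Qed.

Lemma BC1_continuous (u : strip R -> R) : BC1 (u : strip R -> R^o) -> continuous u.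
Proof. by case=> -[]. Qed.

Lemma BC1_bounded (u : strip R -> R) : BC1 (u : strip R -> R^o) ->
  exists M, forall p, `|u p| <= M.
Proof. by case=> -[_ /bounded_funE]. Qed.

Lemma BC1_dt_bounded (u : strip R -> R) : BC1 (u : strip R -> R^o) ->
  exists M, forall p, `|dt (u : strip R -> R^o) p| <= M.
Proof. by case=> _ _ _ _ [_ /bounded_funE]. Qed.

Lemma BC1_dtE (u : strip R -> R) (p : strip R) : BC1 (u : strip R -> R^o) ->
  is_derive p.2 (1 : R) (fun s => u (p.1, s)) (dt (u : strip R -> R^o) p).
Proof.
by case=> _ _ du _ _; apply: DeriveDef; [exact: (du p)|rewrite /dt derive1E].
Qed.

End coefficients.

Theorem theorem2p1 (R : realType) (n m : nat) (n_ge1 : (1 <= n)%N)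
  (m_le_n : (m <= n)%N)
  (a : 'I_n -> strip R -> R) (b : 'I_n -> 'I_n -> strip R -> R)
  (Rb : {linear BC (strip R) 'rV[R]_n -> BC R 'rV[R]_n})
  (Rb_bounded : bounded_op Rb)
  (a_BC1 : forall j, BC1 (a j : strip R -> R^o))
  (b_BC1 : forall j k, BC1 (b j k : strip R -> R^o))
  (a_pos : forall j : 'I_n, (j < m)%N -> 0 < inf (range (a j)))
  (a_neg : forall j : 'I_n, (m <= j)%N -> sup (range (a j)) < 0)
  (Rb_C1 : forall u : BC (strip R) 'rV[R]_n, BC1 u -> BC1R (Rb u))
  (Rb_C1_bounded : exists M : R, forall u : BC (strip R) 'rV[R]_n,
     BC1 u -> norm1R (Rb u) <= M * norm1 u)
  (b_factor : forall j k : 'I_n, j != k ->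
     exists bt : strip R -> R, BC1 (bt : strip R -> R^o) /\
       forall p, b j k p = bt p * (a k p - a j p))
  (C_contr : exists l : nat, (opnorm (iter l (Cop m a b Rb)) < 1%:E)%E)
  (b_decay : forall eps : R, 0 < eps ->
     exists s1 s2 : R, s1 <= s2 /\
       forall (j k : 'I_n) (x : I01 R) (t : R),
         j != k -> t \notin `[s1, s2] -> `|b j k (x, t)| < eps) :
  let ker := [set u : BC (strip R) 'rV[R]_n | bc_solution m a b Rb 0 u] in
  let solvable := [set f : BC (strip R) 'rV[R]_n |
                     exists u, bc_solution m a b Rb f u] in
  (submod_closed [in ker] /\ submod_closed [in solvable] /\
   exists d : nat, has_dim ker d /\ closed solvable /\ has_codim solvable d) /\
  (has_dim ker 0 ->
   forall f : BC (strip R) 'rV[R]_n,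
     exists! u : BC (strip R) 'rV[R]_n, bc_solution m a b Rb f u).
Proof.
move=> ker solvable.
have ca j : continuous (a j) := BC1_continuous (a_BC1 j).
have cb j k : continuous (b j k) := BC1_continuous (b_BC1 j k).
have /choice[c cP] j : exists c, 0 < c /\ forall p, c <= `|a j p|.
  have [bca _ _ _ _] := a_BC1 j.
  have [|c c0 ca'] := bounded_away bca; last by exists c.
  by have [jm|mj] := ltnP j m; [left; exact: a_pos|right; exact: a_neg].
have a_neq0 j p : a j p != 0.
  have [c0 cp] := cP j; rewrite -normr_gt0; exact: lt_le_trans (cp p).
have inv_bound j p : `|(a j p)^-1| <= (c j)^-1.
  by have [c0 cp] := cP j; rewrite normfV lef_pV2// posrE ?normr_gt0.
have [G G0 gG] : exists2 G, 0 <= G & forall j (p : R * R), `|slowness a j p| <= G.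
  apply: (@finite_uniform_bound R _ _ (fun j p => `|slowness a j p|)) => j.
  by exists (c j)^-1 => p; exact: inv_bound.
have [Bb _ bB'] : exists2 B, 0 <= B & forall (jk : 'I_n * 'I_n) p, `|b jk.1 jk.2 p| <= B.
  apply: (@finite_uniform_bound R _ _ (fun jk p => `|b jk.1 jk.2 p|)) => -[j k].
  exact: BC1_bounded (b_BC1 j k).
have bB j k p : `|b j k p| <= Bb := bB' (j, k) p.
have /choice[phi /choice[Q fl]] j : exists phi Q, is_flow (slowness a j) G phi Q.
  pose da (p : R * R) : R := dt (a j : strip R -> R^o) (clamp p.1, p.2).
  have cg : continuous (slowness a j) by exact: slowness_continuous.
  have cda : continuous da by exact: ext_continuous (BC1_dt_continuous (a_BC1 j)).
  (* The time derivative of [1 / a_j], bounded by [G * G * Ma]. *)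
  pose dg (p : R * R) : R := - (slowness a j p * slowness a j p) * da p.
  have cdg : continuous dg.
    have : continuous (fun p : R * R => - (slowness a j p * slowness a j p) * da p) by cont.
    exact.
  have [Ma MaP] := BC1_dt_bounded (a_BC1 j).
  apply: (@flow_exists R (slowness a j) dg G (G * G * Ma) cg cdg _ (gG j)).
    move=> x s; have D := BC1_dtE (clamp x, s) (a_BC1 j).
    have DV := @is_deriveV R (fun s => a j (clamp x, s)) s _ 1 (a_neq0 j (clamp x, s)) D.
    apply: (derive_val (f := fun s => slowness a j (x, s)) DV).
    rewrite /dg /slowness /da /= -[LHS]/(_ * _); congr (- _ * _).
    by rewrite -exprVn expr2.
  move=> p; rewrite /dg normrM normrN normrM ler_pM ?mulr_ge0//.
    by rewrite ler_pM.
  exact: MaP.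
(* A choice over all pairs; the diagonal receives the dummy value 0. *)
have /choice[bt btP] (jk : 'I_n * 'I_n) : exists bt : strip R -> R, continuous bt /\
    (jk.1 != jk.2 -> forall p, b jk.1 jk.2 p = bt p * (a jk.2 p - a jk.1 p)).
  case: jk => j k /=.
  have [->|jk] := eqVneq j k; first by exists (fun=> 0); split => //; exact: cont_cst.
  have [bt [bt1 btE]] := b_factor j k jk.
  by exists bt; split => //; exact: BC1_continuous.
have lin k f f' u u' := @bc_solution_lin R n m a b Rb phi Q G Bb fl gG a_neq0 ca cb bB k f f' u u'.
have [d [dK cS cdS]] := @system_fredholm R n m a b Rb Rb_bounded phi Q G Bb fl gG a_neq0
  ca cb bB (fun j k => bt (j, k)) (fun j k => (btP (j, k)).1)
  (fun j k p jk => (btP (j, k)).2 jk p) b_decay C_contr.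
have ker0 : ker 0.
  rewrite /ker; case: dK => e [_ ->]; exists (fun=> 0) => //.
  by rewrite big1// => i _; rewrite scale0r.
split.
  split; [|split]; last by exists d.
    split; first by rewrite inE.
    move=> k u v; rewrite !inE => ku kv.
    by have := lin k _ _ _ _ ku kv; rewrite scaler0 addr0.
  split; first by rewrite inE; exists 0.
  move=> k f h; rewrite !inE => -[u fu] [v hv].
  by exists (k *: u + v); exact: lin.
move=> [e [_ kerE]].
have ker_eq0 u : ker u -> u = 0 by rewrite kerE => -[w _ <-]; rewrite big_ord0.
(* Both [d] and 0 are dimensions of [ker]. If [d] were positive, its basis vectors would lie in the
   zero space and be dependent. *)
have d0 : d = 0%N.
  case: d dK {cdS} => // d [e' [free spanE]].
  have e'0 i : e' i = 0.
    apply: ker_eq0; rewrite /ker spanE; exists (fun j => (j == i)%:R) => //.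
    rewrite (bigD1 i)//= eqxx scale1r big1 ?addr0// => j /negPf ->.
    by rewrite scale0r.
  have /free/(_ ord0)/eqP : \sum_(i < d.+1) (fun=> 1 : R) i *: e' i = 0.
    by rewrite big1// => i _; rewrite e'0 scaler0.
  by rewrite oner_eq0.
(* In codimension 0 the correcting sum is empty, so [f] itself is solvable; two solutions differ by
   an element of [ker]. *)
move=> f; move: cdS; rewrite d0 => -[e' [_ /(_ f)[w]]].
rewrite big_ord0 subr0 => -[u fu]; exists u; split=> // v fv.
have := lin (-1) _ _ _ _ fu fv.
rewrite !scaleN1r addNr => /ker_eq0/eqP.
by rewrite addrC subr_eq0 => /eqP ->.
Qed.
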